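(* Let $G$ be a finite planar graph, embedded in the plane, that has a perfect matching. Then the cubical complex $\mathcal{C}(G)$ is contractible or a disjoint union of contractible complexes (i.e., every connected component of $\mathcal{C}(G)$ is contractible).
   Context: An elementary cycle (elementary region) of the embedded planar graph $G=(V,E)$ is a cycle of $G$ that bounds a single bounded face of the embedding; an elementary cycle is identified with the region it encircles and with its vertex set / edge set. It is even if it has an even number of vertices. A tiling of $G$ is a partition of $V$ into disjoint blocks, each of which is either the two endpoints $\{x,y\}$ of an edge of $G$, or the vertex set $\{v_1,\dots,v_{2m}\}$ of an even elementary cycle $R$. The tilings form a cubical complex $\mathcal{C}(G)$: a face is a pair $F=(M_F,C_F)$, where $C_F$ is a set of pairwise vertex-disjoint even elementary cycles and $M_F$ is a perfect matching of $G$ minus the vertices of the cycles in $C_F$; its dimension is $|C_F|$, the vertices of $\mathcal{C}(G)$ are the perfect matchings of $G$, and $F_1\subseteq F_2$ iff $C_{F_1}\subseteq C_{F_2}$ and $M_{F_1}\supseteq M_{F_2}$ (a face $(M_F,C_F)$ is the cube whose $2^{|C_F|}$ vertices are obtained by replacing each cycle in $C_F$ by one of its two perfect matchings consisting of every other edge). *)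

(* Defs.v *)
From HB Require Import structures.
From mathcomp Require Export all_boot all_order all_algebra.
From mathcomp Require Export all_classical all_reals all_analysis.

Set Implicit Arguments.
Unset Strict Implicit.
Unset Printing Implicit Defensive.

Import Order.TTheory GRing.Theory Num.Theory.
Import numFieldNormedType.Exports.

Local Open Scope ring_scope.

(* A finite simple graph drawn in the plane R * R: vertices are distinct points,
   edges are (arbitrary continuous) simple arcs joining their end points, and
   two edges, or an edge and a vertex, only meet at common end points.  [arc x y]
   is meaningful only on [0, 1] and when [adj x y]; [arc y x] is the same arc
   traversed backwards. *)
Record plane_graph (R : realType) (V : finType) := PlaneGraph {
  adj : rel V;
  pos : V -> R * R;
  arc : V -> V -> R -> R * R;
  adj_sym : symmetric adj;
  adj_irrefl : irreflexive adj;
  pos_inj : injective pos;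
  arc_cont : forall x y, adj x y -> {within `[0, 1], continuous (arc x y)}%classic;
  arc_inj : forall x y, adj x y -> set_inj `[0, 1]%classic (arc x y);
  arc0 : forall x y, adj x y -> arc x y 0 = pos x;
  arc1 : forall x y, adj x y -> arc x y 1 = pos y;
  arc_rev : forall x y (t : R), adj x y -> 0 <= t <= 1 -> arc y x t = arc x y (1 - t);
  arc_vertex : forall x y v (t : R), adj x y -> 0 < t < 1 -> arc x y t <> pos v;
  arc_disj : forall x y u v (t s : R), adj x y -> adj u v ->
    [set x; y]%SET != [set u; v]%SET ->
    0 < t < 1 -> 0 < s < 1 -> arc x y t <> arc u v s
}.

Section PlaneGraph.
Variables (R : realType) (V : finType) (G : plane_graph R V).

Definition edges : {set {set V}} :=
  [set e : {set V} | [exists x, exists y, adj G x y && (e == [set x; y])]].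

(* A cycle of G is given by its edge set C; its vertex set is then [finset.cover C]. *)
Definition is_cycle (C : {set {set V}}) : Prop :=
  exists c : seq V, [/\ (2 < size c)%N, ucycle (adj G) c &
    C = [set [set x; next c x] | x in c]].

Definition edges_supp (C : {set {set V}}) : set (R * R) :=
  [set p | exists x y (t : R), [/\ adj G x y, [set x; y]%SET \in C, 0 <= t <= 1 &
                             p = arc G x y t]]%classic.

Definition supp : set (R * R) := (range (pos G) `|` edges_supp edges)%classic.

Definition is_region (U : set (R * R)) : Prop :=
  exists2 z, ~ supp z & U = connected_component (~` supp)%classic z.

Definition elementary (C : {set {set V}}) : Prop :=
  is_cycle C /\
  exists U : set (R * R), [/\ is_region U, bounded_set U &
    (closure U `\` interior U)%classic = edges_supp C].

Definition even_elementary (C : {set {set V}}) : Prop :=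
  elementary C /\ ~~ odd #|finset.cover C|.

(* M is a perfect matching of the subgraph of G induced by A. *)
Definition matching_on (A : {set V}) (M : {set {set V}}) : bool :=
  (M \subset edges) && finset.partition M A.

Definition perfect_matching (M : {set {set V}}) : bool :=
  matching_on [set: V] M.

(* F = (M_F, C_F) *)
Definition is_face (F : {set {set V}} * {set {set {set V}}}) : Prop :=
  [/\ forall c, c \in F.2 -> even_elementary c,
      {in F.2 &, forall c c', c != c' -> [disjoint finset.cover c & finset.cover c']} &
      matching_on (~: \bigcup_(c in F.2) finset.cover c) F.1].

(* S is one of the two sets of every other edge of the even cycle c; the other
   one is then c :\: S. *)
Definition alternate (c S : {set {set V}}) : bool :=
  (S \subset c) && finset.partition S (finset.cover c).

Definition edge_ind (S : {set {set V}}) : 'rV[R]_#|{set V}| :=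
  \row_i (enum_val i \in S)%:R.

(* The cube of the face F, realised in the space of edge weightings: its vertices
   are the indicators of the perfect matchings obtained from F by replacing each
   c in C_F by [S c] (t c = 1) or by [c :\: S c] (t c = 0).  Different choices
   of [S] only exchange t c and 1 - t c, so they describe the same cube. *)
Definition cube (F : {set {set V}} * {set {set {set V}}}) :
    set 'rV[R]_#|{set V}| :=
  [set w | exists S : {set {set V}} -> {set {set V}},
           exists t : {set {set V}} -> R,
    [/\ forall c, c \in F.2 -> alternate c (S c),
        forall c, c \in F.2 -> 0 <= t c <= 1 &
        w = edge_ind F.1 + \sum_(c in F.2)
              (t c *: edge_ind (S c) + (1 - t c) *: edge_ind (c :\: S c)%SET)]]%classic.

(* The geometric realisation of C(G).  A point w of the relative interior of
   [cube F] determines F: M_F is where w = 1, and the cycles in C_F are the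
   connected components of the edge set where 0 < w < 1.  Hence the cubes are
   glued exactly along common faces. *)
Definition cubical_complex : set 'rV[R]_#|{set V}| :=
  (\bigcup_(F in [set F | is_face F]) cube F)%classic.

End PlaneGraph.

Definition contractible (R : realType) (T : topologicalType) (A : set T) : Prop :=
  exists2 x0, A x0 & exists H : R * T -> T,
    [/\ {within `[0, 1] `*` A, continuous H}%classic,
        forall (t : R) x, 0 <= t <= 1 -> A x -> A (H (t, x)),
        forall x, A x -> H (0, x) = x &
        forall x, A x -> H (1, x) = x0].

(* Main.v *)
(** Two facts about the bounded faces of a plane graph are needed: an edge lies
    on at most two elementary cycles, and every nonempty family of elementary
    cycles has an edge that lies on exactly one of them.  Both follow from a
    separation criterion of Eilenberg type: if the points [z_i] lie in different
    components of the complement of a compact set [K], then a product of powers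
    of the maps [x - z_i] has no continuous argument on [K] as soon as the
    exponent of some [z_i] in a bounded component is nonzero.  An arc has trivial
    monodromy, so adding one edge to a graph creates only one new integer
    obstruction, and three faces can not meet along an edge.

    Fix a perfect matching [M0].  Flipping an elementary cycle changes its height
    by [1] or [-1]; since [M - M0] is the signed sum of the heights over the
    cycles through each edge, the second fact makes the heights well defined on
    the matchings reachable from [M0].  By the first fact two flips that decrease
    heights in absolute value use vertex-disjoint cycles, so an outward flip
    followed by an inward one cancels or commutes, and every reachable [M] other
    than [M0] spans, together with its inward flips, a cube of positive dimension
    with top vertex [M].  Every cube of the component of [M0] is a face of such a
    cube.  Removing matchings in order of decreasing distance from [M0] collapses
    the component onto [M0] cube by cube. *)

Require Import Defs.
From mathcomp Require Import ring lra zify.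
Import numFieldNormedType.Exports.

Set Implicit Arguments.
Unset Strict Implicit.
Unset Printing Implicit Defensive.

Import Order.TTheory GRing.Theory Num.Theory.

Local Open Scope classical_set_scope.
Local Open Scope ring_scope.

(** * Continuous arguments of planar maps *)

(** A predicate locally constant along [A] has both its truth set and its complement relatively open
    in [A], so connectedness makes it constant. This is the form in which connectedness is used
    below. *)
Lemma connected_locally (T : topologicalType) (A : set T) (P : T -> Prop) :
  connected A ->
  (forall x, A x -> \forall y \near x, A y -> (P y <-> P x)) ->
  forall x y, A x -> A y -> P x -> P y.
Proof.
move=> cA locP x y Ax Ay Px.
have cl Q : (forall x, A x -> \forall y \near x, A y -> (Q y <-> Q x)) ->
    exists2 C, open C & A `&` Q = A `&` C.
  move=> locQ; exists (interior [set z | A z -> Q z]); first exact: open_interior.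
  apply/seteqP; split=> z [Az].
    move=> Qz; split=> //; apply: filterS (locQ _ Az) => u /= h Au.
    exact/(h Au).
  by move=> /interior_subset /(_ Az).
have [C oC AC] := cl _ locP.
have [D oD AD] : exists2 C, open C & A `&` ~` P = A `&` C.
  apply: cl => z Az; apply: filterS (locP _ Az) => u h Au.
  by split=> /= n p; apply: n; apply/(h Au).
have eA : A `&` P = A.
  apply: cA; [by exists x|by exists C|].
  exists (~` D); first exact: open_closedC.
  apply/seteqP; split=> z [Az].
    by move=> Pz; split=> // Dz; have : (A `&` D) z by []; rewrite -AD => -[_]; apply.
  move=> nDz; split=> //; apply: contrapT => nP; apply: nDz.
  by have : (A `&` ~` P) z by []; rewrite AD => -[].
by have : A y by []; rewrite -{1}eA => -[].
Qed.

Section Cvg_pair.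
Variables (R : realType) (T : Type) (F : set_system T).
Hypothesis FF : Filter F.
Implicit Types f g : T -> R * R.

Lemma cvg_fstc f (l : R * R) : f @ F --> l -> (fun x => (f x).1) @ F --> l.1.
Proof. by move=> h; apply: (cvg_comp f fst h); exact: cvg_fst. Qed.

Lemma cvg_sndc f (l : R * R) : f @ F --> l -> (fun x => (f x).2) @ F --> l.2.
Proof. by move=> h; apply: (cvg_comp f snd h); exact: cvg_snd. Qed.

Lemma cvg_pairc (f g : T -> R) (a b : R) :
  f @ F --> a -> g @ F --> b -> (fun x => (f x, g x)) @ F --> (a, b).
Proof. by move=> fa gb; exact: (cvg_pair fa gb). Qed.

End Cvg_pair.

(** * Arguments of nonzero complex numbers *)

Section Angles.
Variable R : realType.
Local Notation P := (R * R)%type.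
Implicit Types (p q u : P) (a b : R).

Definition cis a : P := (cos a, sin a).
Definition cmul p q : P := (p.1 * q.1 - p.2 * q.2, p.1 * q.2 + p.2 * q.1).
Definition cconj p : P := (p.1, - p.2).
Definition dot p q : R := p.1 * q.1 + p.2 * q.2.

(* [a] is an argument of the nonzero complex number [p] *)
Definition polar p a : Prop := exists2 r : R, 0 < r & p = (r * cos a, r * sin a).

Lemma cmul_cis a b : cmul (cis a) (cis b) = cis (a + b).
Proof. by rewrite /cmul /cis /= cosD sinD; congr pair; ring. Qed.

Lemma polar_mul p q a b : polar p a -> polar q b -> polar (cmul p q) (a + b).
Proof.
move=> [r r0 ->] [s s0 ->]; exists (r * s); first exact: mulr_gt0.
by rewrite /cmul /= cosD sinD; congr pair; ring.
Qed.

Lemma polar_conj p a : polar p a -> polar (cconj p) (- a).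
Proof. by move=> [r r0 ->]; exists r => //; rewrite /cconj /= cosN sinN mulrN. Qed.

Lemma dot_gt0 p : p <> (0, 0) -> 0 < dot p p.
Proof.
case: p => x y h; rewrite /dot /=.
have : (x != 0) || (y != 0).
  by apply: contra_notT h; rewrite negb_or !negbK => /andP[/eqP -> /eqP ->].
by case/orP => h1; rewrite -!expr2; [apply: ltr_pwDl|apply: ltr_wpDl];
  rewrite ?exprn_even_gt0 ?sqr_ge0.
Qed.

Lemma polar_neq0 p a : polar p a -> p <> (0, 0).
Proof.
move=> [r r0 ->] [c0 s0]; have := cos2Dsin2 a.
have -> : cos a = 0 by nra.
have -> : sin a = 0 by nra.
by rewrite !expr0n /= addr0 => /esym/eqP; rewrite oner_eq0.
Qed.

Lemma polar_atan (x y : R) : 0 < x -> polar (x, y) (atan (y / x)).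
Proof.
move=> x0; have xn : x != 0 by rewrite gt_eqF.
set t := atan (y / x).
have ct : 0 < cos t.
  by apply: cos_gt0_pihalf; rewrite atan_gtNpi2 atan_ltpi2.
exists (x / cos t); first by rewrite divr_gt0.
have e : sin t / cos t = y / x by rewrite -/(tan t) atanK.
congr pair; first by rewrite divfK // gt_eqF.
by rewrite -mulrA [_^-1 * _]mulrC e mulrC divfK.
Qed.

Lemma polar_exists p : p <> (0, 0) -> exists a, polar p a.
Proof.
case: p => x y h.
have [x0|x0|x0] := ltgtP 0 x.
- by exists (atan (y / x)); exact: polar_atan.
- have [|r r0 [e1 e2]] := @polar_atan (- x) (- y); first by rewrite oppr_gt0.
  exists (atan (- y / - x) + pi); exists r => //.
  by rewrite cosDpi sinDpi !mulrN -e1 -e2 !opprK.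
- have [y0|y0|y0] := ltgtP 0 y.
  + by exists (pi / 2); exists y => //; rewrite cos_pihalf sin_pihalf mulr0 mulr1 x0.
  + exists (- (pi / 2)); exists (- y); first by rewrite oppr_gt0.
    by rewrite cosN sinN cos_pihalf sin_pihalf mulr0 mulrN1 opprK x0.
  + by case: h; rewrite -x0 -y0.
Qed.

Lemma polar_uniq p a b : polar p a -> polar p b -> cis a = cis b.
Proof.
move=> [r r0 ->] [s s0 [e1 e2]].
have rs : r = s.
  have := cos2Dsin2 a; have := cos2Dsin2 b => hb ha.
  have : r ^+ 2 = s ^+ 2.
    rewrite -[LHS]mulr1 -[RHS]mulr1 -{1}ha -hb !mulrDr -!exprMn e1 e2 //.
  by move/eqP; rewrite eqrXn2 ?ltW // => /eqP.
have rn : r != 0 by rewrite gt_eqF.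
by rewrite /cis; congr pair; apply: (mulfI rn); rewrite ?e1 ?e2 rs.
Qed.

(** Removing whole periods leaves [b] in [[0, 2 pi)]. Cosine is injective on [[0, pi]], and for
    [b > pi] the reflected angle [2 pi - b] falls into that interval. *)
Lemma cos_eq1 a : cos a = 1 -> exists k : int, a = pi *+ 2 * k%:~R.
Proof.
have tp0 : 0 < pi *+ 2 :> R by rewrite pmulrn_lgt0 // pi_gt0.
have per (n : nat) b : cos (b + pi *+ 2 * n%:R) = cos b.
  by rewrite mulr_natr (periodicn (@cosD2pi R)).
have perz (k : int) b : cos (b + pi *+ 2 * k%:~R) = cos b.
  case: k => n; first exact: per.
  rewrite NegzE mulrNz mulrN.
  by rewrite -[in RHS](subrK (pi *+ 2 * (n.+1)%:R) b) per.
move=> ca; set k := Num.floor (a / (pi *+ 2)).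
exists k.
set b := a - pi *+ 2 * k%:~R.
have aE : a = b + pi *+ 2 * k%:~R by rewrite subrK.
have cb : cos b = 1 by rewrite -ca [in RHS]aE perz.
suff : b = 0 by rewrite {1}aE => ->; rewrite add0r.
have b0 : 0 <= b.
  by rewrite subr_ge0 mulrC -ler_pdivlMr // floor_le_tmp.
have b1 : b < pi *+ 2.
  rewrite ltrBlDr -[X in X + _]mulr1 -mulrDr addrC mulrC -ltr_pdivrMr //.
  by have := floorD1_gt (a / (pi *+ 2)); rewrite -/k intrD.
have pi0 := @pi_gt0 R.
have [bp|bp] := leP b pi.
  by apply: cos_inj; rewrite ?cb ?cos0 // in_itv /= ?b0 ?bp // lexx ltW.
have : pi *+ 2 - b = 0.
  apply: cos_inj; rewrite ?in_itv /= ?lexx ?(ltW pi0) //.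
    by apply/andP; split; lra.
  by rewrite cosB cos2pi sin2pi cb cos0; ring.
lra.
Qed.

Lemma cis_eq a b : cis a = cis b -> exists k : int, a = b + pi *+ 2 * k%:~R.
Proof.
move=> [c s]; have [|k hk] := @cos_eq1 (a - b).
  by rewrite cosB c s -!expr2 cos2Dsin2.
by exists k; rewrite -hk addrC subrK.
Qed.

Lemma cis_int (k : int) : cis (pi *+ 2 * k%:~R) = (1, 0).
Proof.
suff h (n : nat) : cis (pi *+ 2 * n%:R) = (1, 0).
  case: k => n; first exact: h.
  rewrite NegzE mulrNz mulrN /cis cosN sinN.
  by have [-> ->] := h n.+1; rewrite oppr0.
elim: n => [|n IH]; first by rewrite mulr0 /cis cos0 sin0.
by rewrite -natr1 mulrDr mulr1 -cmul_cis IH /cis cos2pi sin2pi /cmul /= !mulr0 mul0r mulr1 subr0 addr0.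
Qed.

Lemma cisDint a (k : int) : cis (a + pi *+ 2 * k%:~R) = cis a.
Proof. by rewrite -cmul_cis cis_int /cmul /cis /= !mulr1 !mulr0 subr0 add0r. Qed.

End Angles.

(** * Continuous arguments and their homotopy invariance *)

Section HasArg.
Variable R : realType.
Local Notation P := (R * R)%type.

(** A lift of [f / |f|] through the universal cover of the circle, so a statement of trivial winding
    that needs no loops. It forces [f] to be nonzero on [K]. *)
Definition has_arg (T : topologicalType) (K : set T) (f : T -> P) : Prop :=
  exists2 a : T -> R, {within K, continuous a} & forall x, K x -> polar (f x) (a x).

Lemma cvg_dot (T : Type) (F : set_system T) (FF : Filter F) (f g : T -> P) (p q : P) :
  f @ F --> p -> g @ F --> q -> (fun x => dot (f x) (g x)) @ F --> dot p q.
Proof.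
move=> fp gq; apply: cvgD; apply: cvgM; by [exact: cvg_fstc|exact: cvg_sndc].
Qed.

Lemma cvg_cmul (T : Type) (F : set_system T) (FF : Filter F) (f g : T -> P) (p q : P) :
  f @ F --> p -> g @ F --> q -> (fun x => cmul (f x) (g x)) @ F --> cmul p q.
Proof.
move=> fp gq; apply: cvg_pairc; [apply: cvgB|apply: cvgD];
  apply: cvgM; by [exact: cvg_fstc|exact: cvg_sndc].
Qed.

Lemma cvg_cconj (T : Type) (F : set_system T) (FF : Filter F) (f : T -> P) (p : P) :
  f @ F --> p -> (fun x => cconj (f x)) @ F --> cconj p.
Proof.
by move=> fp; apply: cvg_pairc; [exact: cvg_fstc|apply: cvgN; exact: cvg_sndc].
Qed.

(** Positivity of [dot] keeps the quotient [f / g] in the right half-plane, where [atan] is a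
    continuous argument; it corrects the argument of [g] to one of [f]. *)
Lemma has_arg_step (T : topologicalType) (K : set T) (f g : T -> P) :
  {within K, continuous f} -> {within K, continuous g} ->
  (forall x, K x -> 0 < dot (f x) (g x)) -> has_arg K g -> has_arg K f.
Proof.
move=> /subspace_continuousP cf /subspace_continuousP cg fg [a /subspace_continuousP ca ga].
pose q x := cmul (f x) (cconj (g x)).
have q1 x : (q x).1 = dot (f x) (g x) by rewrite /q /cmul /dot /=; ring.
have cq x : K x -> q @ within K (nbhs x) --> q x.
  by move=> Kx; apply: cvg_cmul; [exact: cf|apply: cvg_cconj; exact: cg].
exists (fun x => a x + atan ((q x).2 / (q x).1)).
  apply/subspace_continuousP => x Kx.
  apply: cvgD; first exact: ca.
  apply: (@cvg_comp _ _ _ (fun x => (q x).2 / (q x).1) (@atan R) _ (nbhs ((q x).2 / (q x).1))).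
    apply: cvgM; first by apply: cvg_sndc; exact: cq.
    apply: cvgV; first by rewrite q1 gt_eqF // fg.
    by apply: cvg_fstc; exact: cq.
  exact: continuous_atan.
move=> x Kx.
have h := polar_mul (ga x Kx) (@polar_atan _ (q x).1 (q x).2 _).
have {h}[|r r0 e] := h; first by rewrite q1; exact: fg.
have g0 : 0 < dot (g x) (g x) by apply: dot_gt0; exact: polar_neq0 (ga x Kx).
exists (r / dot (g x) (g x)); first exact: divr_gt0.
case: e; set t := a x + _ => e1 e2; rewrite ![r / _ * _]mulrAC -e1 -e2 /q.
move: g0; rewrite /cmul /cconj /dot /=; case: (f x) => f1 f2 /=.
move: (g x).1 (g x).2 => g1 g2 g0.
by congr pair; field; rewrite gt_eqF.
Qed.

(** Compactness of [K] makes [F (w', x)] and [F (w, x)] have positive inner product for all [x] at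
    once when [w'] is near [w]. By [has_arg_step] the existence of an argument is then locally
    constant in the parameter. *)
Lemma has_arg_homotopy (W T : topologicalType) (A : set W) (K : set T)
    (F : W * T -> P) (w0 w1 : W) :
  connected A -> compact K -> {within A `*` K, continuous F} ->
  (forall w x, A w -> K x -> F (w, x) <> (0, 0)) ->
  A w0 -> A w1 ->
  has_arg K (fun x => F (w0, x)) -> has_arg K (fun x => F (w1, x)).
Proof.
move=> cA cK /subspace_continuousP cF F0 Aw0 Aw1.
have cw w : A w -> {within K, continuous (fun x => F (w, x))}.
  move=> Aw; apply/subspace_continuousP => x Kx.
  apply: (@cvg_comp _ _ _ (fun x => (w, x)) F _ (within (A `*` K) (nbhs (w, x)))).
    move=> S; rewrite /within /= => -[[U V] /= [Uw Vx] UV].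
    by apply: filterS Vx => y Vy Ky; apply: (UV (w, y)) => //; split=> //; exact: nbhs_singleton.
  exact: cF.
have key w : A w -> \forall w' \near w, A w' ->
    forall x, K x -> 0 < dot (F (w', x)) (F (w, x)).
  move=> Aw; move/compact_near_coveringP: (cK) => /(_ W (nbhs w)
    (fun w' x => A w' -> K x -> 0 < dot (F (w', x)) (F (w, x))) _) H.
  have {H}H := H _; apply: filterS (H _) => [w' h Aw' x Kx|x Kx]; first exact: h.
  pose Z := within (A `*` K) (nbhs (w, x)).
  have c1 : F @ Z --> F (w, x) by exact: cF.
  have c2 : (fun z => F (w, z.2)) @ Z --> F (w, x).
    apply: (@cvg_comp _ _ _ (fun z : W * T => (w, z.2)) F _ Z); last exact: cF.
    move=> S; rewrite /Z /within /= => -[[U V] /= [Uw Vx] UV].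
    exists (setT, V) => //=; first by split=> //; exact: filterT.
    move=> [w' y] /= [_ Vy] [_ Ky]; apply: (UV (w, y)) => //.
    by split=> //; exact: nbhs_singleton.
  have := cvg_dot _ c1 c2 => /(_ (within_filter _ _)) c3.
  have : \forall z \near Z, 0 < dot (F z) (F (w, z.2)).
    apply: (cvgr_gt _ c3); apply: dot_gt0; exact: F0.
  rewrite /Z near_withinE /= => -[[U V] /= [Uw Vx] UV].
  exists (V, U) => //= -[y w'] /= [Vy Uw'] Aw' Ky.
  exact: (UV (w', y)).
apply: (connected_locally (P := fun w => has_arg K (fun x => F (w, x))) cA) => // w Aw.
apply: filterS (key w Aw) => w' h Aw'; have {}h := h Aw'.
split; apply: has_arg_step; try exact: cw; last exact: h.
by move=> x Kx; have := h x Kx; rewrite /dot mulrC [X in _ + X]mulrC.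
Qed.

(** Multiples of [2 pi] at distance less than [2 pi] coincide, so [b] is locally constant. *)
Lemma const_2pi (T : topologicalType) (A : set T) (b : T -> R) :
  connected A -> {within A, continuous b} ->
  (forall x, A x -> exists k : int, b x = pi *+ 2 * k%:~R) ->
  forall x y, A x -> A y -> b x = b y.
Proof.
move=> cA /subspace_continuousP cb hb x y Ax Ay.
have tp0 : 0 < pi *+ 2 :> R by rewrite pmulrn_lgt0 // pi_gt0.
apply/esym; apply: (connected_locally (P := fun y => b y = b x) cA _ Ax Ay erefl).
move=> z Az; have := cb z Az => /cvgrPdist_lt /(_ _ tp0); rewrite near_withinE.
apply: filterS => u hu Au; have {hu} : `|b z - b u| < pi *+ 2 by exact: hu.
have [k ->] := hb z Az; have [l ->] := hb u Au.
rewrite -mulrBr -intrB normrM gtr0_norm // gtr_pMr // -intr_norm ltrz1.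
by move=> h; have -> : k = l by lia.
Qed.

End HasArg.

Lemma within_comp (T U W : topologicalType) (A : set T) (B : set U)
    (f : T -> U) (g : U -> W) :
  {within A, continuous f} -> {within B, continuous g} ->
  (forall x, A x -> B (f x)) -> {within A, continuous (fun x => g (f x))}.
Proof.
move=> /subspace_continuousP cf /subspace_continuousP cg AB.
apply/subspace_continuousP => x Ax.
apply: (@cvg_comp _ _ _ f g _ (within B (nbhs (f x)))); last exact: cg (AB _ Ax).
move=> S h; have h2 : within A (nbhs x) (f @^-1` [set y | B y -> S y]) by exact: (cf x Ax _ h).
change (nbhs x [set y | A y -> S (f y)]).
by apply: (filterS (F := nbhs x) _ h2) => y hy Ay; apply: (hy Ay); exact: AB.
Qed.

(** * Integer powers of directions *)

Section Powers.
Variable R : realType.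
Local Notation P := (R * R)%type.

(** Intended for [|u| = 1], where conjugation is inversion; [Negz k] is [- (k + 1)], hence [k.+1]
    factors. *)
Definition cpow (u : P) (n : int) : P :=
  match n with
  | Posz k => iter k (cmul u) (1, 0)
  | Negz k => iter k.+1 (cmul (cconj u)) (1, 0)
  end.

Lemma cpow_cis (a : R) n : cpow (cis a) n = cis (n%:~R * a).
Proof.
have h (b : R) k : iter k (cmul (cis b)) (1, 0) = cis (k%:R * b).
  elim: k => [|k IH] /=; first by rewrite mul0r /cis cos0 sin0.
  by rewrite IH cmul_cis -natr1 mulrDl mul1r addrC.
case: n => k; first exact: h.
rewrite NegzE mulrNz mulNr -mulrN -h /=.
by rewrite /cconj /= /cis cosN sinN.
Qed.

Lemma cvg_cpow (T : Type) (F : set_system T) (FF : Filter F) (f : T -> P) (p : P) n :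
  f @ F --> p -> (fun x => cpow (f x) n) @ F --> cpow p n.
Proof.
have h (g : T -> P) (q : P) k : g @ F --> q ->
    (fun x => iter k (cmul (g x)) (1, 0)) @ F --> iter k (cmul q) (1, 0).
  move=> gq; elim: k => [|k IH] /=; first exact: cvg_cst.
  exact: cvg_cmul.
by move=> fp; case: n => k; apply: h => //; exact: cvg_cconj.
Qed.

Definition unitc (p : P) : P := (p.1 / Num.sqrt (dot p p), p.2 / Num.sqrt (dot p p)).

Lemma polar_unitc p a : polar p a -> unitc p = cis a.
Proof.
move=> [r r0 ->]; rewrite /unitc /dot /=.
have -> : r * cos a * (r * cos a) + r * sin a * (r * sin a) = r ^+ 2.
  by rewrite -[RHS]mulr1 -(cos2Dsin2 a); ring.
rewrite sqrtr_sqr gtr0_norm //.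
by rewrite /cis; congr pair; rewrite mulrAC divff ?mul1r // gt_eqF.
Qed.

Lemma cvg_unitc (T : Type) (F : set_system T) (FF : Filter F) (f : T -> P) (p : P) :
  p <> (0, 0) -> f @ F --> p -> (fun x => unitc (f x)) @ F --> unitc p.
Proof.
move=> p0 fp.
have d : (fun x => Num.sqrt (dot (f x) (f x))) @ F --> Num.sqrt (dot p p).
  apply: (@cvg_comp _ _ _ (fun x => dot (f x) (f x)) (@Num.sqrt R) _ (nbhs (dot p p))); first exact: cvg_dot.
  exact: sqrt_continuous.
apply: cvg_pairc; apply: cvgM; try (by [exact: cvg_fstc|exact: cvg_sndc]);
  by apply: cvgV => //; rewrite gt_eqF // sqrtr_gt0 dot_gt0.
Qed.

End Powers.

(** * Components of plane complements, arcs and continuous arguments *)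

Section PlaneTopology.
Variable R : realType.
Local Notation P := (R * R)%type.

Lemma ball_connected (x : P) (e : R) : connected (ball x e).
Proof.
have [e0|e0] := ltP 0 e; last first.
  rewrite (_ : ball x e = set0); first exact: connected0.
  rewrite -subset0 => y; rewrite -ball_normE /= => h.
  by have := lt_le_trans h e0; rewrite ltNge normr_ge0.
pose s (y : P) := (fun t : R => x + t *: (y - x)) @` `[0, 1].
rewrite (_ : ball x e = \bigcup_(y in ball x e) s y).
  apply: bigcup_connected.
    exists x => y _; exists 0; rewrite /= ?in_itv /= ?lexx ?ler01 //.
    by rewrite scale0r addr0.
  move=> y _; apply: connected_continuous_connected; first exact: segment_connected.
  apply: continuous_subspaceT => t; apply: cvgD; first exact: cvg_cst.
  by apply: cvgZ; [exact: cvg_id|exact: cvg_cst].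
apply/seteqP; split=> [y hy|y [z hz [t /=]]].
  exists y => //; exists 1; rewrite /= ?in_itv /= ?lexx ?ler01 //.
  by rewrite scale1r addrC subrK.
rewrite in_itv /= => /andP[t0 t1] <-; move: hz; rewrite -!ball_normE /=.
rewrite opprD addrA subrr sub0r normrN normrZ ger0_norm // => h.
by apply: le_lt_trans h; rewrite -[leRHS]mul1r -normrN opprB ler_wpM2r.
Qed.

Lemma component_open (K : set P) (z : P) :
  closed K -> open (connected_component (~` K) z).
Proof.
move=> cK; rewrite openE => y Cy; have nKy := connected_component_sub Cy.
have : nbhs y (~` K) by apply: open_nbhs_nbhs; split=> //; exact: closed_openC.
move=> /nbhs_ballP[e /= e0 eK]; apply/nbhs_ballP; exists e => // u yu.
apply: (connected_component_trans Cy).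
by apply: (connected_component_max _ eK (@ball_connected y e)) => //; exact: ballxx.
Qed.

Lemma closure_component (K : set P) (z : P) : closed K ->
  closure (connected_component (~` K) z) `<=` connected_component (~` K) z `|` K.
Proof.
move=> cK y Cy; have [Ky|nKy] := pselect (K y); [by right|left].
have : nbhs y (~` K) by apply: open_nbhs_nbhs; split=> //; exact: closed_openC.
move=> /nbhs_ballP[e /= e0 eK].
have [|u [Cu yu]] := Cy (ball y e); first by apply/nbhs_ballP; exists e.
apply: (connected_component_trans Cu).
apply: (connected_component_max _ eK (@ball_connected y e)) => //; exact: ballxx.
Qed.

(** A continuous injection of a compact set into a Hausdorff space is a homeomorphism onto its
    image, so the argument can be carried over by the inverse of [g]. *)
Lemma has_arg_image (T U : topologicalType) (K : set T) (g : T -> U) (f : U -> P) :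
  hausdorff_space U -> compact K -> {within K, continuous g} -> set_inj K g ->
  has_arg K (fun t => f (g t)) -> has_arg (g @` K) f.
Proof.
move=> hU cK cg gi [a ca fa].
have [[t0 Kt0]|K0] := pselect (K !=set0); last first.
  exists (fun=> 0); last by move=> x [t Kt _]; case: K0; exists t.
  by apply: continuous_subspaceT => x; exact: cvg_cst.
(* This is [a] after the inverse of [g]; the default [t0] only matters off the image. *)
pose b y := a (xget t0 [set t | K t /\ g t = y]).
have bg t : K t -> b (g t) = a t.
  move=> Kt; rewrite /b; case: xgetP => [s -> [Ks gst]|/(_ t)]; last by case.
  by congr a; apply: gi; rewrite ?inE.
exists b; last by move=> _ [t Kt <-]; rewrite bg //; exact: fa.
apply/continuous_closedP => W cW; apply/closed_subspaceP.
move/continuous_closedP: ca => /(_ W cW) /closed_subspaceP[V cV VK].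
exists (g @` (K `&` V)).
  apply: compact_closed => //; apply: continuous_compact.
    by apply: continuous_subspaceW cg => ? [].
  exact: compact_closedI.
apply/seteqP; split=> y [].
  move=> [t [Kt Vt] <-] _; split; last by exists t.
  change (W (b (g t))); rewrite bg //.
  by have [] : (from_subspace K a @^-1` W `&` K) t by rewrite -VK.
move=> + [t Kt yt]; rewrite -yt => Wb; have {Wb} : W (b (g t)) by exact: Wb.
rewrite bg // => Wat; split; exists t => //.
by split=> //; have [] : (V `&` K) t by rewrite VK.
Qed.

Local Notation I01 := (`[0, 1]%classic : set R).

Lemma itv01_mul (s t : R) : I01 s -> I01 t -> I01 (s * t).
Proof.
rewrite /= !in_itv /= => /andP[s0 s1] /andP[t0 t1]; apply/andP; split.
  exact: mulr_ge0.
by rewrite -[leRHS]mulr1 ler_pM.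
Qed.

Lemma itv01_0 : I01 0. Proof. by rewrite /= in_itv /= lexx ler01. Qed.
Lemma itv01_1 : I01 1. Proof. by rewrite /= in_itv /= lexx ler01. Qed.

(** The homotopy [s * t] shrinks the arc to its starting point, where [f] is constant and any fixed
    angle serves. *)
Lemma has_arg_arc (g : R -> P) (f : P -> P) :
  {within `[0, 1], continuous g} -> set_inj `[0, 1] g ->
  {within g @` `[0, 1], continuous f} ->
  (forall x, (g @` `[0, 1]) x -> f x <> (0, 0)) ->
  has_arg (g @` `[0, 1]) f.
Proof.
move=> cg gi cf f0; apply: has_arg_image => //; first exact: segment_compact.
have := @has_arg_homotopy R R R `[0, 1] `[0, 1] (fun st => f (g (st.1 * st.2))) 0 1.
rewrite (_ : (fun x => f (g ((1, x).1 * (1, x).2))) = fun x => f (g x)); last first.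
  by apply/funext => x /=; rewrite mul1r.
apply; try exact: itv01_0; try exact: itv01_1.
- exact: segment_connected.
- exact: segment_compact.
- apply: (within_comp _ cf); last first.
    by move=> [s t] [/= hs ht]; exists (s * t) => //; exact: itv01_mul.
  apply: (within_comp _ cg); last by move=> [s t] [/= hs ht]; exact: itv01_mul.
  apply: continuous_subspaceT => -[s t]; apply: cvgM; [exact: cvg_fst|exact: cvg_snd].
- move=> s t hs ht; apply: f0; exists (s * t) => //; exact: itv01_mul.
- have [|b hb] := @polar_exists R (f (g 0)); first by apply: f0; exists 0; [exact: itv01_0|].
  exists (fun=> b); last by move=> x _ /=; rewrite mul0r.
  by apply: continuous_subspaceT => x; exact: cvg_cst.
Qed.

(** The product with the conjugate stands for the quotient [(x - w) / (x - z)] up to a positive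
    factor. Moving [w] to [z] inside the component deforms it to [|x - z|^2], whose argument is
    0. *)
Lemma has_arg_component (K : set P) (z w : P) : compact K ->
  connected_component (~` K) z w ->
  has_arg K (fun x => cmul (x - w) (cconj (x - z))).
Proof.
move=> cK zw.
have nz : ~ K z by case: zw => A [Az /(_ _ Az)].
have sub (x y : P) : x - y = (0, 0) -> x = y.
  by case: x y => x1 x2 [y1 y2] [] /eqP; rewrite subr_eq0 => /eqP -> /eqP; rewrite subr_eq0 => /eqP ->.
have := @has_arg_homotopy R P P (connected_component (~` K) z) K
  (fun wx => cmul (wx.2 - wx.1) (cconj (wx.2 - z))) z w.
apply => //.
- exact: component_connected.
- apply: continuous_subspaceT => -[u x]; apply: cvg_cmul.
    by apply: cvgB; [exact: cvg_snd|exact: cvg_fst].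
  by apply: cvg_cconj; apply: cvgB; [exact: cvg_snd|exact: cvg_cst].
- move=> u x Cu Kx /=.
  have [|a ha] := @polar_exists R (x - u).
    by move/sub => xu; apply: (connected_component_sub Cu); rewrite -xu.
  have [|b hb] := @polar_exists R (x - z); first by move/sub => xz; apply: nz; rewrite -xz.
  exact: polar_neq0 (polar_mul ha (polar_conj hb)).
- exact: connected_component_refl.
- exists (fun=> 0); first by apply: continuous_subspaceT => x; exact: cvg_cst.
  move=> x Kx /=; exists (dot (x - z) (x - z)).
    by apply: dot_gt0 => /sub xz; apply: nz; rewrite -xz.
  by rewrite /cmul /dot /cconj cos0 sin0 /=; congr pair; ring.
Qed.

End PlaneTopology.

(** * Winding numbers around points of bounded components *)

Section Independence.
Variable R : realType.
Local Notation P := (R * R)%type.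

Lemma subP0 (x y : P) : x <> y -> x - y <> (0, 0).
Proof.
move=> xy e; apply: xy; case: x y e => x1 x2 [y1 y2] [].
by move=> /eqP; rewrite subr_eq0 => /eqP -> /eqP; rewrite subr_eq0 => /eqP ->.
Qed.

(** The norm of [R * R] is the maximum of the coordinates, so a point of the Euclidean unit circle
    has norm at least [1 / sqrt 2]; the cruder [1 / 2] suffices. *)
Lemma cis_norm (a r : R) : 0 < r -> r / 2 <= `|r *: cis a : P|.
Proof.
move=> r0; have := cos2Dsin2 a; set c := cos a; set s := sin a => h.
rewrite leNgt; apply/negP; rewrite /cis -/c -/s.
rewrite (_ : _ *: _ = (r * c, r * s)) // prod_normE /= gt_max !ltr_norml.
by move=> /andP[/andP[h1 h2] /andP[h3 h4]]; nra.
Qed.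

(* A map that extends [cpow (unitc (x - z1)) n1] from outside [U] to a
   nonvanishing map on the whole plane has winding number 0 on large circles. *)
Lemma arg_independent (K U : set P) (z1 z2 z3 : P) (n1 n2 n3 : int) (a : P -> R) :
  compact K -> open U -> bounded_set U -> closure U `<=` U `|` K -> ~ K z1 ->
  U z1 -> ~ (U `|` K) z2 -> ~ (U `|` K) z3 -> {within K, continuous a} ->
  (forall x t1 t2 t3, K x -> ~ U x -> polar (x - z1) t1 -> polar (x - z2) t2 ->
     polar (x - z3) t3 ->
     cis (a x) = cis (n1%:~R * t1 + n2%:~R * t2 + n3%:~R * t3)) ->
  n1 = 0.
Proof.
move=> cK oU bU clU nK1 Uz1 nz2 nz3 ca ha.
have hP : hausdorff_space P by exact: norm_hausdorff.
have clK : closed K by exact: compact_closed.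
(* Tietze extension of [a] from the compact set [K] to the whole plane. *)
have [A [aA cA _]] : exists A : P -> R, [/\ {in K, a =1 A}, continuous A & True].
  have [M M0 aM] : exists2 M, 0 < M & forall x, K x -> `|a x| <= M.
    have := compact_bounded (continuous_compact ca cK) => /pinfty_ex_gt0[M M0 h].
    by exists M => // x Kx; apply: (h (a x)); exists x.
  have [||A [h1 h2 h3]] := @continuous_bounded_extension P R _ K _ a M M0 ca aM => //.
    exact: pseudometric_normal.
  by exists A.
(* Outside [U] the map is the power around [z1]. Inside, [f2] expresses it by [A] and the powers
   around [z2] and [z3], which has no singularity on [closure U]; the hypothesis on [a] makes the
   two agree on the boundary. *)
pose f1 (x : P) := cpow (unitc (x - z1)) n1.
pose f2 (x : P) := cmul (cis (A x)) (cmul (cpow (unitc (x - z2)) (- n2)) (cpow (unitc (x - z3)) (- n3))).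
pose f x := if x \in U then f2 x else f1 x.
have f1P x : x <> z1 -> exists2 t, polar (x - z1) t & f1 x = cis (n1%:~R * t).
  move=> /subP0 /polar_exists[t ht]; exists t => //.
  by rewrite /f1 (polar_unitc ht) cpow_cis.
have f2P x : ~ (x = z2 \/ x = z3) -> exists t2 t3, [/\ polar (x - z2) t2, polar (x - z3) t3 &
    f2 x = cis (A x - n2%:~R * t2 - n3%:~R * t3)].
  move=> /not_orP[/subP0 /polar_exists[t2 h2] /subP0 /polar_exists[t3 h3]].
  exists t2, t3; split=> //; rewrite /f2 (polar_unitc h2) (polar_unitc h3) !cpow_cis !cmul_cis.
  by rewrite !mulrNz !mulNr addrA.
have cU x : closure U x -> ~ (x = z2 \/ x = z3).
  by move=> /clU Ux [xz|xz]; [apply: nz2|apply: nz3]; rewrite -xz.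
have UCz x : ~ U x -> x <> z1 by move=> nU e; apply: nU; rewrite e.
have f12 x : closure U x -> ~ U x -> f1 x = f2 x.
  move=> clx nUx; have Kx : K x by case: (clU _ clx).
  have [t1 h1 ->] := f1P x (UCz x nUx).
  have [t2 [t3 [h2 h3 ->]]] := f2P x (cU x clx).
  have := ha x t1 t2 t3 Kx nUx h1 h2 h3.
  rewrite aA ?inE // => /cis_eq[k ->].
  have -> : n1%:~R * t1 + n2%:~R * t2 + n3%:~R * t3 + pi *+ 2 * k%:~R
     - n2%:~R * t2 - n3%:~R * t3 = n1%:~R * t1 + pi *+ 2 * k%:~R by ring.
  by rewrite cisDint.
have ff1 x : ~ U x -> f x = f1 x.
  by rewrite /f; case: ifPn => // /set_mem.
have ff2 x : closure U x -> f x = f2 x.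
  by move=> clx; rewrite /f; case: ifPn => // /negP nU; apply: f12 => // /mem_set.
have cf : continuous f.
  have h : {within [set: P], continuous f}.
    rewrite (_ : [set: P] = closure U `|` ~` U); last first.
      apply/seteqP; split=> // x _; have [Ux|] := pselect (U x); last by right.
      by left; exact: subset_closure.
    apply: withinU_continuous; [exact: closed_closure|exact: open_closedC| |].
    - apply: (@subspace_eq_continuous _ _ _ f2); first by move=> x /set_mem /ff2.
      apply: continuous_in_subspaceT => x /set_mem /cU /not_orP[x2 x3].
      apply: cvg_cmul.
        apply: cvg_pairc; (apply: (@cvg_comp _ _ _ A _ _ (nbhs (A x))); first exact: cA).
          exact: continuous_cos.
        exact: continuous_sin.
      by apply: cvg_cmul; apply: cvg_cpow; apply: cvg_unitc;
        try exact: subP0; apply: cvgB; try exact: cvg_cst; exact: cvg_id.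
    - apply: (@subspace_eq_continuous _ _ _ f1); first by move=> x /set_mem /ff1.
      apply: continuous_in_subspaceT => x /set_mem /UCz x1.
      by apply: cvg_cpow; apply: cvg_unitc; first exact: subP0;
        apply: cvgB; [exact: cvg_id|exact: cvg_cst].
  by move=> x; have := h x; rewrite /continuous_at nbhs_subspaceT.
have fP x : exists t, f x = cis t.
  have [Ux|nUx] := pselect (U x).
    rewrite ff2; last exact: subset_closure.
    have [t2 [t3 [_ _ ->]]] := f2P x (cU x (subset_closure Ux)).
    by eexists.
  by rewrite ff1 //; have [t _ ->] := f1P x (UCz x nUx); eexists.
have cis0 t : cis t <> (0, 0) :> P.
  by apply: (@polar_neq0 _ _ t); exists 1 => //; rewrite !mul1r.
have [M M0 UM] : exists2 M : R, 0 < M & forall x, U x -> `|x| <= M.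
  have := bU => /pinfty_ex_gt0[M M0 h].
  by exists M => // x Ux; exact: (h x).
(* Any two points of [U] are within [2 * M], while [cis_norm] puts the circle of radius [r] about
   [z1] at distance at least [2 * M + 2], so the circle misses [U]. *)
pose r := 4 * M + 4.
have r0 : 0 < r by rewrite /r; lra.
pose c (t : R) : P := z1 + r *: cis t.
have cU' t : ~ U (c t).
  move=> /UM h; have h1 := UM _ Uz1; have h2 := cis_norm t r0.
  have : `|r *: cis t : P| <= M + M.
    rewrite (_ : r *: cis t = c t - z1); last by rewrite /c addrC addKr.
    by apply: (le_trans (ler_normB _ _)); exact: lerD.
  by rewrite /r in h2 *; lra.
have pc t : polar (c t - z1) t.
  by exists r => //; rewrite /c addrC addKr.
have cc : continuous c.
  move=> t; apply: cvgD; first exact: cvg_cst.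
  apply: cvgZ; first exact: cvg_cst.
  by apply: cvg_pairc; [exact: continuous_cos|exact: continuous_sin].
pose I := (`[0, pi *+ 2]%classic : set R).
have cKc : compact (c @` I).
  apply: continuous_compact; last exact: segment_compact.
  exact: continuous_subspaceT.
(* The circle shrinks to [z1] in the plane, and [f] vanishes nowhere on the way. *)
have [b cb fb] : has_arg (c @` I) f.
  have := @has_arg_homotopy R R P `[0, 1] (c @` I) (fun tx => f (z1 + tx.1 *: (tx.2 - z1))) 0 1.
  rewrite (_ : (fun x => f (z1 + (1, x).1 *: ((1, x).2 - z1))) = f); last first.
    by apply/funext => x /=; rewrite scale1r addrC subrK.
  apply => //.
  - exact: segment_connected.
  - apply: continuous_subspaceT => -[t x].
    apply: (@cvg_comp _ _ _ (fun tx : R * P => z1 + tx.1 *: (tx.2 - z1)) f _ (nbhs (z1 + t *: (x - z1)))); last exact: cf.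
    apply: cvgD; first exact: cvg_cst.
    apply: cvgZ; first exact: cvg_fst.
    by apply: cvgB; [exact: cvg_snd|exact: cvg_cst].
  - by move=> t x _ _ /=; have [s ->] := fP (z1 + t *: (x - z1)).
  - exact: itv01_0.
  - exact: itv01_1.
  - have [s hs] := fP z1; exists (fun=> s).
      by apply: continuous_subspaceT => x; exact: cvg_cst.
    by move=> x _ /=; rewrite scale0r addr0 hs; exists 1 => //; rewrite !mul1r.
have tp0 : 0 < pi *+ 2 :> R by rewrite pmulrn_lgt0 // pi_gt0.
have I0 : I 0 by rewrite /I /= in_itv /= lexx ltW.
have I1 : I (pi *+ 2) by rewrite /I /= in_itv /= lexx ltW.
(* On the circle [f] is [f1], with argument [n1 * t]; as [c] closes up after [2 pi], constancy of
   the difference leaves [n1 * 2 pi = 0]. *)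
have := @const_2pi R R I (fun t => b (c t) - n1%:~R * t) _ _ _ 0 (pi *+ 2) I0 I1.
have -> : c (pi *+ 2) = c 0 by rewrite /c /cis cos2pi sin2pi cos0 sin0.
move=> h; have {h} : b (c 0) - n1%:~R * 0 = b (c 0) - n1%:~R * (pi *+ 2).
  apply: h; first exact: segment_connected.
    apply/subspace_continuousP => t It; apply: cvgB.
      have : {within I, continuous (fun t => b (c t))}.
        by apply: (within_comp _ cb); [exact: continuous_subspaceT|move=> s Is; exists s].
      by move=> /subspace_continuousP /(_ t It).
    apply: cvgM; first exact: cvg_cst.
    by apply: cvg_within_filter; exact: cvg_id.
  move=> t It.
  have ct : (c @` I) (c t) by exists t.
  have := fb _ ct; rewrite ff1 // /f1 (polar_unitc (pc t)) cpow_cis => h.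
  have [|k ->] := @cis_eq R (b (c t)) (n1%:~R * t).
    by apply: (polar_uniq h); exists 1 => //; rewrite !mul1r.
  by exists k; ring.
move=> /eqP; rewrite mulr0 subr0 -subr_eq0 opprB addrC subrK.
by rewrite mulf_eq0 [X in _ || X]gt_eqF // orbF intr_eq0 => /eqP.
Qed.

End Independence.

(** * An arc does not border three components *)

Section ThreeSides.
Variable R : realType.
Local Notation P := (R * R)%type.

Lemma int_relation (p q : int) :
  exists n m : int, (n != 0) || (m != 0) /\ n * p + m * q = 0.
Proof.
have [->|q0] := eqVneq q 0.
  by exists 0, 1; rewrite oner_eq0 orbT mul0r mulr0 addr0.
by exists q, (- p); rewrite q0; split => //; ring.
Qed.

Lemma polar_quot_eq (p q : P) (a s t : R) : polar (cmul p (cconj q)) a ->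
  polar p s -> polar q t -> exists k : int, a = s - t + pi *+ 2 * k%:~R.
Proof.
by move=> ha hs ht; apply: cis_eq; exact: polar_uniq ha (polar_mul hs (polar_conj ht)).
Qed.

(* Passing around the end points of the arc changes the arguments of
   [(x - z1) / (x - z2)] and [(x - z1) / (x - z3)] by integer multiples of
   [2 pi], and two integers always satisfy a linear relation. *)
Lemma three_sides_false (K B : set P) (g : R -> P) (z1 z2 z3 : P) :
  compact K -> {within `[0, 1], continuous g} -> set_inj `[0, 1] g ->
  K (g 0) -> K (g 1) ->
  (forall t : R, 0 < t < 1 -> ~ K (g t)) ->
  connected B -> B `<=` ~` K -> B z1 -> B z2 -> B z3 ->
  let L := K `|` g @` `[0, 1] in
  ~ L z1 -> ~ L z2 -> ~ L z3 ->
  bounded_set (connected_component (~` L) z1) ->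
  bounded_set (connected_component (~` L) z2) ->
  ~ connected_component (~` L) z1 z2 ->
  ~ connected_component (~` L) z1 z3 ->
  ~ connected_component (~` L) z2 z3 -> False.
Proof.
move=> cK cg gi K0 K1 gK cB BK Bz1 Bz2 Bz3 L nz1 nz2 nz3 b1 b2 n12 n13 n23.
pose e := (g @` `[0, 1]) : set P.
have ce : compact e by apply: continuous_compact => //; exact: segment_compact.
have hP : hausdorff_space P by exact: norm_hausdorff.
have clK : closed K by exact: compact_closed.
have cle : closed e by exact: compact_closed.
have cL : compact L.
  exact: compactU.
have clL : closed L by exact: compact_closed.
have arcE x : e x -> K x -> x = g 0 \/ x = g 1.
  move=> [t /=]; rewrite in_itv /= => /andP[t0 t1] <- Kt.
  move: t0 t1; rewrite !le_eqVlt => /orP[/eqP <-|t0]; first by left.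
  move=> /orP[/eqP ->|t1]; first by right.
  by case: (gK t); rewrite ?t0 ?t1.
have e0 : e (g 0) by exists 0 => //; exact: itv01_0.
have e1 : e (g 1) by exists 1 => //; exact: itv01_1.
have Lne x z : L x -> ~ L z -> x <> z by move=> Lx nLz xz; apply: nLz; rewrite -xz.
have eL x : e x -> L x by right.
have KL x : K x -> L x by left.
(* The quotient [(x - z1) / (x - z)] has an argument on [K] because [B] joins the two points off
   [K], and on the arc by [has_arg_arc]. The two arguments need not match at the end points. *)
have args z : B z -> ~ L z -> exists a b : P -> R,
    [/\ {within K, continuous a}, {within e, continuous b},
     forall x, K x -> polar (cmul (x - z1) (cconj (x - z))) (a x) &
     forall x, e x -> polar (cmul (x - z1) (cconj (x - z))) (b x)].
  move=> Bz nLz.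
  have [|a ca ha] := @has_arg_component R K z z1 cK.
    exact: (connected_component_max Bz BK cB Bz1).
  have [||b cb hb] := @has_arg_arc R g (fun x => cmul (x - z1) (cconj (x - z))) cg gi.
  - apply: continuous_subspaceT => x; apply: cvg_cmul.
      by apply: cvgB; [exact: cvg_id|exact: cvg_cst].
    by apply: cvg_cconj; apply: cvgB; [exact: cvg_id|exact: cvg_cst].
  - move=> x ex.
    have /subP0 /polar_exists[s hs] := Lne x z1 (eL _ ex) nz1.
    have /subP0 /polar_exists[t ht] := Lne x z (eL _ ex) nLz.
    exact: polar_neq0 (polar_mul hs (polar_conj ht)).
  - by exists a, b; split.
have [a2 [c2 [ca2 cc2 ha2 hc2]]] := args z2 Bz2 nz2.
have [a3 [c3 [ca3 cc3 ha3 hc3]]] := args z3 Bz3 nz3.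
have dif (a b : P -> R) z x : K x -> e x ->
    (forall x, K x -> polar (cmul (x - z1) (cconj (x - z))) (a x)) ->
    (forall x, e x -> polar (cmul (x - z1) (cconj (x - z))) (b x)) ->
    exists k : int, a x = b x + pi *+ 2 * k%:~R.
  by move=> Kx ex ha hb; apply: cis_eq; apply: polar_uniq (ha x Kx) (hb x ex).
have [k20 h20] := dif _ _ _ _ K0 e0 ha2 hc2.
have [k21 h21] := dif _ _ _ _ K1 e1 ha2 hc2.
have [k30 h30] := dif _ _ _ _ K0 e0 ha3 hc3.
have [k31 h31] := dif _ _ _ _ K1 e1 ha3 hc3.
have [n [m [nm0 nm]]] := int_relation (k20 - k21) (k30 - k31).
have nmR : n%:~R * (k20%:~R - k21%:~R) + m%:~R * (k30%:~R - k31%:~R) = 0 :> R.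
  by rewrite -!intrB -!intrM -intrD nm.
(* The relation between [n] and [m] says that the combined jump is [2 pi * kk] at both ends of the
   arc, so one shift on the arc glues the arguments on all of [L]. *)
pose kk : int := n * k20 + m * k30.
pose A1 x := n%:~R * a2 x + m%:~R * a3 x.
pose A2 x := n%:~R * c2 x + m%:~R * c3 x + pi *+ 2 * kk%:~R.
pose A x := if x \in K then A1 x else A2 x.
have A12 x : K x -> e x -> A1 x = A2 x.
  move=> Kx ex; have [->|->] := arcE x ex Kx; rewrite /A1 /A2 /kk intrD !intrM.
    by rewrite h20 h30; ring.
  rewrite h21 h31; apply/eqP; rewrite -subr_eq0; apply/eqP.
  transitivity (- (pi *+ 2) * (n%:~R * (k20%:~R - k21%:~R) + m%:~R * (k30%:~R - k31%:~R)) : R).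
    by ring.
  by rewrite nmR mulr0.
have AK x : K x -> A x = A1 x by move=> Kx; rewrite /A mem_set.
have Ae x : e x -> A x = A2 x.
  by move=> ex; rewrite /A; case: ifPn => // /set_mem Kx; exact: A12.
have cA : {within L, continuous A}.
  apply: withinU_continuous => //.
  - apply: (@subspace_eq_continuous _ _ _ A1); first by move=> x /set_mem /AK.
    move/subspace_continuousP: ca2 => ca2; move/subspace_continuousP: ca3 => ca3.
    apply/subspace_continuousP => x Kx; apply: cvgD; apply: cvgM; try exact: cvg_cst.
      exact: ca2.
    exact: ca3.
  - apply: (@subspace_eq_continuous _ _ _ A2); first by move=> x /set_mem /Ae.
    move/subspace_continuousP: cc2 => cc2; move/subspace_continuousP: cc3 => cc3.
    apply/subspace_continuousP => x ex; apply: cvgD; last exact: cvg_cst.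
    apply: cvgD; apply: cvgM; try exact: cvg_cst.
      exact: cc2.
    exact: cc3.
have hA x t1 t2 t3 : L x -> polar (x - z1) t1 -> polar (x - z2) t2 -> polar (x - z3) t3 ->
    cis (A x) = cis ((n + m)%:~R * t1 + (- n)%:~R * t2 + (- m)%:~R * t3).
  move=> Lx p1 p2 p3.
  suff [k ->] : exists k : int, A x =
      ((n + m)%:~R * t1 + (- n)%:~R * t2 + (- m)%:~R * t3) + pi *+ 2 * k%:~R.
    exact: cisDint.
  case: Lx => [Kx|ex].
    have [k hk] := polar_quot_eq (ha2 x Kx) p1 p2.
    have [l hl] := polar_quot_eq (ha3 x Kx) p1 p3.
    rewrite AK // /A1 hk hl; exists (n * k + m * l).
    by rewrite !intrD !mulrNz !intrM; ring.
  have [k hk] := polar_quot_eq (hc2 x ex) p1 p2.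
  have [l hl] := polar_quot_eq (hc3 x ex) p1 p3.
  rewrite Ae // /A2 hk hl; exists (n * k + m * l + kk).
  by rewrite !intrD !mulrNz !intrM; ring.
(* The exponents at [z1], [z2], [z3] are [n + m], [- n], [- m]. Vanishing at the bounded components
   of [z1] and [z2] gives [n = m = 0], against the choice of the relation. *)
have nm1 : n + m = 0.
  apply: (@arg_independent R L (connected_component (~` L) z1) z1 z2 z3 (n + m) (- n) (- m) A) => //.
  - exact: component_open.
  - exact: closure_component.
  - exact: connected_component_refl.
  - by case.
  - by case.
  - by move=> x t1 t2 t3 Lx _; exact: hA.
have nm2 : - n = 0.
  apply: (@arg_independent R L (connected_component (~` L) z2) z2 z1 z3 (- n) (n + m) (- m) A) => //.
  - exact: component_open.
  - exact: closure_component.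
  - exact: connected_component_refl.
  - by case=> // /connected_component_sym.
  - by case.
  - by move=> x t1 t2 t3 Lx _ p1 p2 p3; rewrite (hA x t2 t1 t3) // [X in cis (X + _)]addrC.
by move: nm0; lia.
Qed.

End ThreeSides.

(** * Faces of a plane graph *)

(** Passes compactness and closedness to finite unions, by induction on an enumeration of the index
    type. *)
Lemma fin_union_ind (T : Type) (I : finType) (D : pred I) (F : I -> set T)
    (Q : set T -> Prop) :
  Q set0 -> (forall A B, Q A -> Q B -> Q (A `|` B)) ->
  (forall i, D i -> Q (F i)) -> Q [set x | exists2 i, D i & F i x].
Proof.
move=> Q0 QU QF.
suff h (s : seq I) : Q [set x | exists2 i, (i \in s) && D i & F i x].
  have := h (enum I); congr Q; apply/seteqP; split=> x [i Di Fx]; exists i => //.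
    by case/andP: Di.
  by rewrite mem_enum.
elim: s => [|j s IH].
  rewrite (_ : [set x | _] = set0) // -subset0 => x [i] //.
case Dj: (D j).
  rewrite (_ : [set x | _] = F j `|` [set x | exists2 i, (i \in s) && D i & F i x]).
    by apply: QU => //; exact: QF.
  apply/seteqP; split=> x.
    by move=> [i]; rewrite inE => /andP[/orP[/eqP ->|is_] Di] Fx; [left|right; exists i; rewrite ?is_].
  move=> [Fx|[i /andP[is_ Di] Fx]]; first by exists j; rewrite // inE eqxx Dj.
  by exists i; rewrite // inE is_ Di orbT.
rewrite (_ : [set x | _] = [set x | exists2 i, (i \in s) && D i & F i x]) //.
apply/seteqP; split=> x [i]; last first.
  by move=> /andP[is_ Di] Fx; exists i; rewrite // inE is_ Di orbT.
rewrite inE => /andP[/orP[/eqP ->|is_] Di] Fx; first by rewrite Dj in Di.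
by exists i; rewrite ?is_.
Qed.

Lemma avoid_seq (R : realType) (s : seq R) (a b : R) :
  a < b -> exists2 y, a < y < b & y \notin s.
Proof.
elim: s a b => [|h s IH] a b ab.
  by exists ((a + b) / 2) => //; apply/andP; split; lra.
have [/andP[ah hb]|hn] := boolP (a < h < b).
  have [y /andP[y1 y2] ys] := IH a h ah.
  exists y; first by rewrite y1 (lt_trans y2).
  by rewrite inE negb_or ys lt_eqF.
have [y y1 ys] := IH a b ab; exists y => //.
by rewrite inE negb_or ys andbT; apply: contraNneq hn => <-.
Qed.

Section PlaneGraphTopology.
Variables (R : realType) (V : finType) (G : plane_graph R V).
Local Notation P := (R * R)%type.

Lemma edge_adj e : e \in edges G -> exists x y, adj G x y /\ e = [set x; y]%SET.
Proof. by rewrite inE => /existsP[x /existsP[y /andP[xy /eqP ->]]]; exists x, y. Qed.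

Lemma adj_edge x y : adj G x y -> [set x; y]%SET \in edges G.
Proof. by move=> xy; rewrite inE; apply/existsP; exists x; apply/existsP; exists y; rewrite xy /=. Qed.

Lemma edges_supp_compact C : compact (edges_supp G C).
Proof.
rewrite (_ : edges_supp G C = [set p | exists2 xy : V * V,
    adj G xy.1 xy.2 && ([set xy.1; xy.2]%SET \in C) & (arc G xy.1 xy.2 @` `[0, 1]) p]).
  apply: (@fin_union_ind _ _ _ _ compact); [exact: compact0|by move=> A B; exact: compactU|].
  move=> [x y] /= /andP[xy _]; apply: continuous_compact; last exact: segment_compact.
  exact: arc_cont.
apply/seteqP; split=> p.
  move=> [x [y [t [xy xyC t01 ->]]]]; exists (x, y); rewrite /= ?xy ?xyC //.
  by exists t; rewrite //= in_itv.
move=> [[x y] /= /andP[xy xyC] [t /=]]; rewrite in_itv /= => t01 <-.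
by exists x, y, t.
Qed.

Lemma pos_compact : compact (range (pos G)).
Proof.
rewrite (_ : range (pos G) = [set p | exists2 v : V, true & [set pos G v] p]).
  apply: (@fin_union_ind _ _ _ _ compact); [exact: compact0|by move=> A B; exact: compactU|].
  by move=> v _; exact: compact_set1.
apply/seteqP; split=> p; first by move=> [v _ <-]; exists v.
by move=> [v _ ->]; exists v.
Qed.

Lemma supp_compact : compact (supp G).
Proof. by apply: compactU; [exact: pos_compact|exact: edges_supp_compact]. Qed.

Lemma supp_closed : closed (supp G).
Proof. by apply: compact_closed; [exact: norm_hausdorff|exact: supp_compact]. Qed.

Definition supp_without (e : {set V}) : set P :=
  range (pos G) `|` edges_supp G (edges G :\ e).

Lemma supp_without_compact e : compact (supp_without e).
Proof. by apply: compactU; [exact: pos_compact|exact: edges_supp_compact]. Qed.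

Lemma supp_split x y : adj G x y ->
  supp G = supp_without [set x; y]%SET `|` arc G x y @` `[0, 1].
Proof.
move=> xy; apply/seteqP; split=> p.
  move=> [hp|[u [v [t [uv uvE t01 ->]]]]]; first by left; left.
  have [exy|nxy] := eqVneq [set u; v]%SET [set x; y]%SET; last first.
    by left; right; exists u, v, t; rewrite in_setD1 nxy.
  right; have uxy : u \in [set x; y]%SET by rewrite -exy in_set2 eqxx.
  have vxy : v \in [set x; y]%SET by rewrite -exy in_set2 eqxx orbT.
  have nuv : u != v by apply: contraTneq uv => ->; rewrite adj_irrefl.
  have [hu|hu] : u = x \/ u = y by move: uxy; rewrite in_set2 => /orP[] /eqP; [left|right].
    have hv : v = y by move: vxy nuv; rewrite hu in_set2 => /orP[] /eqP -> //; rewrite eqxx.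
    by rewrite hu hv; exists t => //; rewrite /= in_itv.
  have hv : v = x by move: vxy nuv; rewrite hu in_set2 => /orP[] /eqP -> //; rewrite eqxx.
  rewrite hu hv; exists (1 - t); last by rewrite -arc_rev.
  by rewrite /= in_itv /=; case/andP: t01 => t0 t1; apply/andP; split; lra.
move=> [[hp|[u [v [t [uv]]]]]|[t /=]]; first by left.
  by rewrite in_setD1 => /andP[_ uvE] t01 ->; right; exists u, v, t.
rewrite in_itv /= => t01 <-; right; exists x, y, t; split=> //; exact: adj_edge.
Qed.

Lemma arc_notin_edges_supp (C : {set {set V}}) x y (t : R) : adj G x y -> [set x; y]%SET \notin C ->
  0 < t < 1 -> ~ edges_supp G C (arc G x y t).
Proof.
move=> xy xyC t01 [u [v [s [uv uvC s01 e]]]].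
have ne : [set x; y]%SET != [set u; v]%SET by apply: contraNneq xyC => ->.
move: s01; rewrite !le_eqVlt => /andP[/orP[/eqP s0|s0] /orP[/eqP s1|s1]].
- by move: e; rewrite -s0 arc0 //; exact: arc_vertex.
- by move: e; rewrite -s0 arc0 //; exact: arc_vertex.
- by move: e; rewrite s1 arc1 //; exact: arc_vertex.
- by apply: arc_disj ne t01 _ e; rewrite ?s0 ?s1.
Qed.

Lemma arc_notin_supp_without x y (t : R) : adj G x y -> 0 < t < 1 ->
  ~ supp_without [set x; y]%SET (arc G x y t).
Proof.
move=> xy t01 [[v _]|]; first by move/esym; exact: arc_vertex.
by apply: arc_notin_edges_supp => //; rewrite in_setD1 eqxx.
Qed.

Lemma region_open U : is_region G U -> open U.
Proof. by move=> [z _ ->]; apply: component_open; exact: supp_closed. Qed.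

Lemma region_component U z : is_region G U -> U z ->
  ~ supp G z /\ U = connected_component (~` supp G) z.
Proof.
move=> [u nu ->] Uz; split; first exact: (connected_component_sub Uz).
exact: same_connected_component.
Qed.

Lemma region_inj U W z : is_region G U -> is_region G W -> U z -> W z -> U = W.
Proof. by move=> hU hW /(region_component hU)[_ ->] /(region_component hW)[_ ->]. Qed.

(** A small ball about an inner point of the edge avoids the rest of the graph and meets both [U]
    and [W]. A point of a third face in that ball would contradict [three_sides_false], with the
    edge as the arc. *)
Lemma two_sides x y (t : R) U W : adj G x y -> 0 < t < 1 ->
  is_region G U -> is_region G W -> bounded_set U -> bounded_set W -> U <> W ->
  closure U (arc G x y t) -> closure W (arc G x y t) ->
  \forall q \near arc G x y t,
    ~ supp_without [set x; y]%SET q /\ (~ supp G q -> U q \/ W q).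
Proof.
move=> xy t01 rU rW bU bW UW clU clW; set p := arc G x y t.
have cS := @supp_without_compact [set x; y]%SET.
have : nbhs p (~` supp_without [set x; y]%SET).
  apply: open_nbhs_nbhs; split; last exact: arc_notin_supp_without.
  by apply: closed_openC; apply: compact_closed cS; exact: norm_hausdorff.
move=> /nbhs_ballP[e /= e0 eS].
have np : nbhs p (ball p e) by exact: nbhsx_ballx.
have [z1 [Uz1 pz1]] := clU _ np; have [z2 [Wz2 pz2]] := clW _ np.
have [n1 UE] := region_component rU Uz1; have [n2 WE] := region_component rW Wz2.
apply: filterS np => q pq; split; first exact: eS.
move=> nq; have [Uq|nUq] := pselect (U q); [by left|right].
apply: contrapT => nWq.
have [g0 g1] := (arc0 xy, arc1 xy).
apply: (@three_sides_false R (supp_without [set x; y]%SET) (ball p e) (arc G x y) z1 z2 q) => //;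
  rewrite -?supp_split -?UE -?WE //.
- exact: arc_cont.
- exact: arc_inj.
- by rewrite g0; left; exists x.
- by rewrite g1; left; exists y.
- by move=> s s01; exact: arc_notin_supp_without.
- exact: ball_connected.
- by move=> Uz2; apply: UW; exact: region_inj Uz2 Wz2.
Qed.

Lemma cycle_edges C : is_cycle G C -> C \subset edges G.
Proof.
move=> [c [_ /andP[cyc _] ->]]; apply/fintype.subsetP => e /imsetP[x xc ->].
exact/adj_edge/next_cycle.
Qed.

(** The midpoint of an edge lies on no other edge, so it identifies the edge. *)
Lemma edges_supp_sub (C D : {set {set V}}) : C \subset edges G ->
  edges_supp G C `<=` edges_supp G D -> C \subset D.
Proof.
move=> CE h; apply/fintype.subsetP => e eC.
have [x [y [xy exy]]] := edge_adj (fintype.subsetP CE _ eC).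
apply: contrapT => /negP; rewrite exy => eD.
have := @arc_notin_edges_supp D x y (2^-1) xy eD.
have t01 : 0 < (2^-1 : R) < 1 by apply/andP; split; lra.
apply => //; apply: h; exists x, y, (2^-1); split=> //; first by rewrite -exy.
by case/andP: t01 => t0 t1; rewrite !ltW.
Qed.

Lemma edges_supp_inj (C D : {set {set V}}) : C \subset edges G -> D \subset edges G ->
  edges_supp G C = edges_supp G D -> C = D.
Proof.
move=> CE DE CD; apply/eqP; rewrite finset.eqEsubset.
by apply/andP; split; apply: edges_supp_sub => //; rewrite CD.
Qed.

Definition bounds (C : {set {set V}}) (U : set P) : Prop :=
  [/\ is_region G U, bounded_set U & closure U `\` interior U = edges_supp G C].

Lemma bounds_closure C U p : bounds C U -> edges_supp G C p -> closure U p.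
Proof. by move=> [_ _ <-] []. Qed.

Lemma bounds_neq (C D : {set {set V}}) U W : is_cycle G C -> is_cycle G D -> bounds C U -> bounds D W ->
  C != D -> U <> W.
Proof.
move=> cC cD [_ _ eU] [_ _ eW] /eqP CD UW; apply: CD.
by apply: edges_supp_inj; rewrite ?cycle_edges // -eU -eW UW.
Qed.

(** The midpoint of [e] is in the closure of all three regions, but near it [two_sides] leaves only
    the first two off the graph. *)
Lemma edge_at_most_two (e : {set V}) (c1 c2 c3 : {set {set V}}) :
  elementary G c1 -> elementary G c2 -> elementary G c3 ->
  e \in c1 -> e \in c2 -> e \in c3 ->
  c1 != c2 -> c1 != c3 -> c2 != c3 -> False.
Proof.
move=> [y1 [U1 b1]] [y2 [U2 b2]] [y3 [U3 b3]] e1 e2 e3 n12 n13 n23.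
have [x [y [xy exy]]] := edge_adj (fintype.subsetP (cycle_edges y1) _ e1).
have t01 : 0 < (2^-1 : R) < 1 by apply/andP; split; lra.
have cl c U : bounds c U -> e \in c -> closure U (arc G x y (2^-1)).
  move=> bc ec; apply: (bounds_closure bc); exists x, y, (2^-1).
  by split; rewrite -?exy //; case/andP: t01 => t0 t1; rewrite !ltW.
have [r1 B1 _] := b1; have [r2 B2 _] := b2; have [r3 B3 _] := b3.
have := two_sides xy t01 r1 r2 B1 B2 (bounds_neq y1 y2 b1 b2 n12) (cl _ _ b1 e1) (cl _ _ b2 e2).
move=> h; have [q [U3q [_ hq]]] := cl _ _ b3 e3 _ h.
have [nq _] := region_component r3 U3q.
have [U1q|U2q] := hq nq.
  exact: (bounds_neq y1 y3 b1 b3 n13 (region_inj r1 r3 U1q U3q)).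
exact: (bounds_neq y2 y3 b2 b3 n23 (region_inj r2 r3 U2q U3q)).
Qed.

(** Otherwise every boundary edge has regions of the family on both sides, so the union [W] of their
    closures could only be left through a vertex. A horizontal ray that misses all vertices and
    starts in [W] would then never leave this bounded set. *)
Lemma private_edge (S : {set {set {set V}}}) (c0 : {set {set V}}) :
  c0 \in S -> (forall c, c \in S -> elementary G c) ->
  exists e c, [/\ c \in S, e \in c & forall c', c' \in S -> e \in c' -> c' = c].
Proof.
move=> c0S Sel; apply: contrapT => noe.
have other e c : c \in S -> e \in c -> exists2 c', c' \in S & e \in c' /\ c' != c.
  move=> cS ec; apply: contrapT => h; apply: noe; exists e, c; split=> // c' c'S ec'.
  by apply/eqP; apply: contrapT => /negP ne; apply: h; exists c'.
have cyc c : c \in S -> is_cycle G c by move=> /Sel[].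
pose U c := xget set0 (bounds c).
have bU c : c \in S -> bounds c (U c).
  move=> /Sel[_ [W bW]]; rewrite /U; case: xgetP => [Z -> //|/(_ W)]; case; exact: bW.
pose W := [set q | exists2 c, c \in S & closure (U c) q].
have clW : closed W.
  apply: (@fin_union_ind _ _ (mem S) _ closed); first exact: closed0.
    by move=> A B; exact: closedU.
  by move=> c _; exact: closed_closure.
have clUW c : c \in S -> U c `<=` W.
  by move=> cS q Uq; exists c => //; exact: subset_closure.
(* At an inner point of a boundary edge, nearby points off the graph lie in the two regions by
   [two_sides], and nearby points of the graph lie on that same edge. *)
have opW q : W q -> (forall v, q <> pos G v) -> nbhs q W.
  move=> [c cS clq] nv; have [rc Bc fc] := bU c cS.
  have [Uq|nUq] := pselect (U c q).
    by apply: filterS (clUW c cS) _; apply: open_nbhs_nbhs; split=> //; exact: region_open rc.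
  have : edges_supp G c q by rewrite -fc; split=> // /interior_subset.
  move=> [x [y [t [xy xyc /andP[t0 t1] qE]]]].
  have t01 : 0 < t < 1.
    rewrite !lt_def t0 t1 !andbT; apply/andP; split; apply/eqP => e0.
      by apply: (nv x); rewrite qE e0 arc0.
    by apply: (nv y); rewrite qE -e0 arc1.
  have [c' c'S [xyc' nc]] := other _ _ cS xyc.
  have [rc' Bc' fc'] := bU c' c'S.
  have sq (d : {set {set V}}) : [set x; y]%SET \in d -> edges_supp G d q.
    by move=> xyd; exists x, y, t; rewrite t0 t1.
  have UU : U c <> U c'.
    by apply: (bounds_neq (cyc _ cS) (cyc _ c'S) (bU _ cS) (bU _ c'S)); rewrite eq_sym.
  rewrite qE; have := two_sides xy t01 rc rc' Bc Bc' UU _ _; rewrite -qE => h.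
  apply: filterS (h _ _) => [r [nr hr]||].
  - have [sr|nsr] := pselect (supp G r); last first.
      by have [Ur|Ur] := hr nsr; [exact: (clUW c)|exact: (clUW c')].
    exists c => //; apply: (bounds_closure (bU _ cS)).
    move: sr; rewrite (supp_split xy) => -[//|[s /=]].
    by rewrite in_itv /= => s01 <-; exists x, y, s.
  - exact: (bounds_closure (bU _ cS) (sq _ xyc)).
  - exact: (bounds_closure (bU _ c'S) (sq _ xyc')).
have [M M0 WM] : exists2 M : R, 0 < M & forall q, W q -> `|q| <= M.
  have h c : c \in S -> exists2 M : R, 0 < M & forall q, closure (U c) q -> `|q| <= M.
    move=> cS; have [_ + _] := bU c cS => /pinfty_ex_gt0[M M0 h].
    exists M => // q clq; rewrite leNgt; apply/negP => Mq.
    have [|r [Ur qr]] := clq (ball q (`|q| - M)).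
      by apply: nbhsx_ballx; rewrite subr_gt0.
    have := h r Ur; move: qr; rewrite -ball_normE /= => h1 h2.
    have := ler_normD (q - r) r; rewrite subrK; lra.
  pose m c := xget 1 [set M : R | 0 < M /\ forall q, closure (U c) q -> `|q| <= M].
  have hm c : c \in S -> 0 < m c /\ forall q, closure (U c) q -> `|q| <= m c.
    by move=> /h[M M0 hM]; rewrite /m; case: xgetP => [Z -> //|/(_ M)]; case.
  exists (\sum_(c in S) m c).
    rewrite (bigD1 c0) //= ltr_pwDl //; first by case: (hm c0 c0S).
    by apply: sumr_ge0 => c /andP[/hm[/ltW]].
  move=> q [c cS clq]; apply: (le_trans ((hm c cS).2 _ clq)).
  rewrite (bigD1 c) //= lerDl; apply: sumr_ge0 => d /andP[/hm[/ltW]] //.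
have [z Uz] : exists z, U c0 z.
  have [[z nz ->] _ _] := bU c0 c0S; exists z; exact: connected_component_refl.
have [rc0 _ _] := bU c0 c0S.
have : nbhs z (U c0) by apply: open_nbhs_nbhs; split=> //; exact: region_open.
move=> /nbhs_ballP[e /= e0 eU].
(* A height that differs from those of all vertices, yet close enough to [z.2] for the ray to start
   in [U c0]. *)
have [|y0 /andP[y1 y2] ys] := @avoid_seq R [seq (pos G v).2 | v <- enum V] (z.2 - e) (z.2 + e).
  by lra.
pose l (s : R) : P := (z.1 + s, y0).
have nl s v : l s <> pos G v.
  by move=> e1; move/negP: ys; apply; apply/mapP; exists v; rewrite ?mem_enum // -e1.
have cl : continuous l.
  move=> s; apply: cvg_pairc; last exact: cvg_cst.
  by apply: cvgD; [exact: cvg_cst|exact: cvg_id].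
(* At this parameter the abscissa [z.1 + S1] is at least [M + 1], beyond the bound on [W]. *)
pose S1 := `|z| + M + 1.
have S0 : 0 <= S1 by rewrite /S1; have := normr_ge0 z; lra.
have : W (l S1).
  apply: (@connected_locally _ (`[0, S1]%classic : set R) (fun s => W (l s)) _ _ 0).
  - exact: segment_connected.
  - move=> s _; have [Ws|nWs] := pselect (W (l s)).
      have h : nbhs s (l @^-1` W) by exact: (cl s _ (opW _ Ws (nl s))).
      by apply: filterS h => s' Ws' _; split.
    have : nbhs (l s) (~` W) by apply: open_nbhs_nbhs; split=> //; exact: closed_openC.
    move=> h; have {}h : nbhs s (l @^-1` (~` W)) by exact: (cl s _ h).
    by apply: filterS h => s' nWs' _; split.
  - by rewrite /= in_itv /= lexx.
  - by rewrite /= in_itv /= lexx S0.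
  - apply: (clUW c0 c0S); apply: eU; rewrite /l addr0.
    rewrite -ball_normE /= prod_normE /= gt_max subrr normr0 e0 /= ltr_norml.
    by apply/andP; split; lra.
move=> /WM; rewrite prod_normE /= ge_max => /andP[+ _].
have : `|z.1| <= `|z| by rewrite prod_normE le_max lexx.
rewrite ler_norml => /andP[h1 h2]; rewrite ler_norml => /andP[h3 h4].
by rewrite /S1 in h4; lra.
Qed.

End PlaneGraphTopology.

(** * Collapsing *)

Section Contraction.
Variables (R : realType) (T : topologicalType).
Local Notation I := (`[0, 1]%classic : set R).

Definition contracts (A : set T) (x0 : T) : Prop :=
  A x0 /\ exists H : R * T -> T,
    [/\ {within I `*` A, continuous H},
        forall t x, I t -> A x -> A (H (t, x)),
        forall x, A x -> H (0, x) = x &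
        forall x, A x -> H (1, x) = x0].

Lemma contracts_contractible A x0 : contracts A x0 -> contractible R A.
Proof.
move=> [Ax0 [H [cH HA H0 H1]]]; exists x0 => //; by exists H; split.
Qed.

Lemma contracts_connected A x0 : contracts A x0 -> connected A.
Proof.
move=> [Ax0 [H [cH HA H0 H1]]].
rewrite (_ : A = \bigcup_(x in A) ((fun t => H (t, x)) @` I)).
  apply: bigcup_connected.
    by exists x0 => x Ax; exists 1; [exact: itv01_1|exact: H1].
  move=> x Ax; apply: connected_continuous_connected; first exact: segment_connected.
  apply: (@within_comp _ _ _ I (I `*` A) (fun t => (t, x)) H) => //.
  by apply: continuous_subspaceT => t; exact: (cvg_pair cvg_id (cvg_cst _)).
apply/seteqP; split=> [x Ax|x [y Ay [t It <-]]]; last exact: HA.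
by exists x => //; exists 0; [exact: itv01_0|exact: H0].
Qed.

Lemma contracts1 x0 : contracts [set x0] x0.
Proof.
split=> //; exists (fun=> x0).
split; [|by []| |by []]; last by move=> x ->.
by apply: continuous_subspaceT => x; exact: cvg_cst.
Qed.

Lemma closed_prod (U W : topologicalType) (A : set U) (B : set W) :
  closed A -> closed B -> closed (A `*` B).
Proof.
move=> cA cB; rewrite (_ : A `*` B = fst @^-1` A `&` snd @^-1` B) //.
by apply: closedI; apply: preimage_closed => //;
  [move=> x _; exact: cvg_fst|move=> x _; exact: cvg_snd].
Qed.

(** [K] pushes [A] into [B] and fixes the overlap, so it extends by the identity on [B]; closedness
    of both sets permits pasting. Contracting [B] afterwards finishes. *)
Lemma contracts_collapse (A B : set T) x0 (K : R * T -> T) :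
  closed A -> closed B -> {within I `*` A, continuous K} ->
  (forall t x, I t -> A x -> A (K (t, x))) ->
  (forall x, A x -> K (0, x) = x) -> (forall x, A x -> B (K (1, x))) ->
  (forall t x, I t -> A x -> B x -> K (t, x) = x) ->
  contracts B x0 -> contracts (A `|` B) x0.
Proof.
move=> cA cB cK KA K0 K1 KB [Bx0 [H [cH HB H0 H1]]]; split; first by right.
pose r (tx : R * T) := if tx.2 \in A then K tx else tx.2.
have cI (a b : R) : closed (`[a, b]%classic : set R) by exact: interval_closed.
have rA t x : A x -> r (t, x) = K (t, x) by move=> Ax; rewrite /r mem_set.
have rB t x : I t -> B x -> r (t, x) = x.
  by move=> It Bx; rewrite /r /=; case: ifPn => // /set_mem Ax; exact: KB.
have cr : {within I `*` (A `|` B), continuous r}.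
  rewrite (_ : I `*` (A `|` B) = (I `*` A) `|` (I `*` B)); last first.
    by apply/seteqP; split=> -[t x] /=; [move=> [It [Ax|Bx]]; [left|right]|move=> [[It Ax]|[It Bx]]; split=> //; [left|right]].
  apply: withinU_continuous; [exact: closed_prod|exact: closed_prod| |].
  - apply: (@subspace_eq_continuous _ _ _ K) => //.
    by move=> [t x] /set_mem [/= It Ax]; rewrite -(rA t x).
  - apply: (@subspace_eq_continuous _ _ _ (snd : R * T -> T)).
      by move=> [t x] /set_mem [/= It Bx]; exact/esym/(rB t x It Bx).
    by apply: continuous_subspaceT => x; exact: cvg_snd.
have rAB t x : I t -> (A `|` B) x -> (A `|` B) (r (t, x)).
  by move=> It [Ax|Bx]; [left; rewrite rA //; exact: KA|right; rewrite rB].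
have r1 x : (A `|` B) x -> B (r (1, x)).
  by move=> [Ax|Bx]; [rewrite rA //; exact: K1|rewrite rB //; exact: itv01_1].
have r0 x : (A `|` B) x -> r (0, x) = x.
  by move=> [Ax|Bx]; [rewrite rA //; exact: K0|rewrite rB //; exact: itv01_0].
(* Concatenation at double speed; the halves agree at [2^-1] because [H] starts at the identity. *)
pose L (tx : R * T) := if tx.1 <= 2^-1 then r (2 * tx.1, tx.2) else H (2 * tx.1 - 1, r (1, tx.2)).
have L1 t x : t <= 2^-1 -> L (t, x) = r (2 * t, x) by rewrite /L /= => ->.
have L2 t x : (A `|` B) x -> 2^-1 <= t -> L (t, x) = H (2 * t - 1, r (1, x)).
  move=> ABx; rewrite le_eqVlt => /orP[/eqP <-|h]; last by rewrite /L /= leNgt h.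
  by rewrite L1 // divff // subrr H0 //; exact: r1.
have I1 t : (`[0, 2^-1]%classic : set R) t -> I (2 * t).
  by rewrite /= !in_itv /= => /andP[h1 h2]; apply/andP; split; lra.
have I2 t : (`[2^-1, 1]%classic : set R) t -> I (2 * t - 1).
  by rewrite /= !in_itv /= => /andP[h1 h2]; apply/andP; split; lra.
have split_I t : I t -> (`[0, 2^-1]%classic : set R) t \/ (`[2^-1, 1]%classic : set R) t.
  rewrite /= !in_itv /= => /andP[t0 t1]; have [h|h] := leP t 2^-1; [left|right].
    by rewrite t0.
  by rewrite t1 ltW.
have c2 : continuous (fun tx : R * T => 2 * tx.1).
  by move=> x; apply: cvgM; [exact: cvg_cst|exact: cvg_fst].
exists L; split.
- rewrite (_ : I `*` _ = (`[0, 2^-1]%classic `*` (A `|` B)) `|` (`[2^-1, 1]%classic `*` (A `|` B))); last first.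
    apply/seteqP; split=> -[t x] /=.
      by move=> [/split_I[h|h] ABx]; [left|right].
    rewrite !in_itv /= => -[] [/andP[h1 h2] ABx]; split=> //; apply/andP; split; lra.
  have cAB : closed (A `|` B) by exact: closedU.
  apply: withinU_continuous; [exact: closed_prod|exact: closed_prod| |].
  - apply: (@subspace_eq_continuous _ _ _ (fun tx : R * T => r (2 * tx.1, tx.2))).
      by move=> [t x] /set_mem [/=]; rewrite in_itv /= => /andP[_ h] _; exact/esym/L1.
    apply: (@within_comp _ _ _ _ (I `*` (A `|` B)) (fun tx : R * T => (2 * tx.1, tx.2)) r) => //.
      by apply: continuous_subspaceT => x; exact: (cvg_pair (c2 x) cvg_snd).
    by move=> [t x] [/= h ABx]; split=> //; exact: I1.
  - apply: (@subspace_eq_continuous _ _ _ (fun tx : R * T => H (2 * tx.1 - 1, r (1, tx.2)))).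
      by move=> [t x] /set_mem [/=]; rewrite in_itv /= => /andP[h _] ABx; exact/esym/L2.
    apply: (@within_comp _ _ _ _ (I `*` B) (fun tx : R * T => (2 * tx.1 - 1, r (1, tx.2))) H) => //.
      have : {within `[2^-1, 1]%classic `*` (A `|` B), continuous (fun tx : R * T => r (1, tx.2))}.
        apply: (@within_comp _ _ _ _ (I `*` (A `|` B)) (fun tx : R * T => (1, tx.2)) r) => //.
          by apply: continuous_subspaceT => x; exact: (cvg_pair (cvg_cst _) cvg_snd).
        by move=> [t x] [/= h ABx]; split=> //; exact: itv01_1.
      move/subspace_continuousP => c3; apply/subspace_continuousP => x Dx.
      have c4 : (fun tx : R * T => 2 * tx.1 - 1) @
          within (`[2^-1, 1]%classic `*` (A `|` B)) (nbhs x) --> 2 * x.1 - 1.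
        by apply: cvg_within_filter; apply: cvgB; [exact: c2|exact: cvg_cst].
      exact: (cvg_pair c4 (c3 x Dx)).
    by move=> [t x] [/= h ABx]; split=> /=; [exact: I2|exact: r1].
- move=> t x It ABx; have [h|h] := split_I t It.
    by rewrite L1; [apply: rAB => //; exact: I1|move: h; rewrite /= in_itv /= => /andP[]].
  rewrite L2 //; last by move: h; rewrite /= in_itv /= => /andP[].
  by right; apply: HB; [exact: I2|exact: r1].
- by move=> x ABx; rewrite L1 ?mulr0 ?r0 // invr_ge0.
- move=> x ABx; rewrite L2 //; last by rewrite invf_le1 // ler1n.
  by rewrite (_ : 2 * 1 - 1 = 1 :> R); [exact: H1 (r1 _ ABx)|ring].
Qed.

End Contraction.

Local Close Scope classical_set_scope.

(** * Flips of perfect matchings *)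

Section Exact.
Variable V : finType.
Implicit Types (S M A c : {set {set V}}) (e f : {set V}) (v : V).

(** The partition condition read at one vertex, convenient because a flip only alters the edges at
    the vertices of one cycle. *)
Definition covers_once S v : Prop :=
  exists2 e, e \in S /\ v \in e & forall f, f \in S -> v \in f -> f = e.

Lemma covers_once_uniq S v e f : covers_once S v ->
  e \in S -> f \in S -> v \in e -> v \in f -> e = f.
Proof. by move=> [g _ h] eS fS ve vf; rewrite (h e) // (h f). Qed.

Lemma partition_once (B : {set V}) S v : finset.partition S B -> v \in B -> covers_once S v.
Proof.
move=> /and3P[/eqP <- /finset.trivIsetP tS _] /bigcupP[e eS ve]; exists e => // f fS vf.
apply: contrapT => /eqP ne; have := tS f e fS eS ne.
by move=> /disjointFr /(_ vf); rewrite ve.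
Qed.

Lemma once_partition (B : {set V}) S : finset.set0 \notin S ->
  {in S, forall e, e \subset B} -> {in B, forall v, covers_once S v} ->
  finset.partition S B.
Proof.
move=> S0 SB SO; apply/and3P; split=> //.
  rewrite finset.eqEsubset; apply/andP; split.
    by apply/bigcupsP => e; exact: SB.
  by apply/fintype.subsetP => v /SO[e [eS ve] _]; apply/bigcupP; exists e.
apply/finset.trivIsetP => e f eS fS; apply: contraR => /pred0Pn[v /= /andP[ve vf]].
apply/eqP; apply: (covers_once_uniq (S := S) (v := v)) => //.
by apply: SO; exact: (fintype.subsetP (SB e eS)).
Qed.

Lemma alternateP c S : finset.set0 \notin c ->
  reflect (S \subset c /\ {in finset.cover c, forall v, covers_once S v}) (alternate c S).
Proof.
move=> c0; apply: (iffP andP) => -[Sc h]; split=> //.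
  by move=> v vc; exact: partition_once h vc.
apply: once_partition => //.
  by apply: contra c0; exact: (fintype.subsetP Sc).
by move=> e eS; apply: finset.bigcup_sup; exact: (fintype.subsetP Sc).
Qed.

(* connected graph, all of whose vertices have degree 2 *)
Definition circuit c : Prop :=
  [/\ c != finset.set0, finset.set0 \notin c,
      forall v, v \in finset.cover c -> exists e f,
        [/\ e \in c /\ v \in e, f \in c /\ v \in f, e <> f &
            forall g, g \in c -> v \in g -> g = e \/ g = f] &
      forall (A : V -> Prop) x, x \in finset.cover c -> A x ->
        (forall e u v, e \in c -> u \in e -> v \in e -> A u -> A v) ->
        forall y, y \in finset.cover c -> A y].

Lemma alternate_compl c S : circuit c -> alternate c S -> alternate c (c :\: S).
Proof.
move=> [_ c0 deg _] /(alternateP _ c0)[Sc SO]; apply/alternateP => //; split.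
  exact: finset.subsetDl.
move=> v vc; have [e [f [[ec ve] [fc vf] ef h]]] := deg v vc.
have [g [gS vg] gU] := SO v vc.
wlog ge : e f ec ve fc vf ef h / g = e.
  move=> W; have [ge|gf] := h g (fintype.subsetP Sc _ gS) vg; first exact: (W e f).
  apply: (W f e) => //; first by move=> fe; apply: ef.
  by move=> k kc vk; case: (h k kc vk); [right|left].
exists f.
  split=> //; rewrite finset.in_setD fc andbT; apply/negP => fS; apply: ef.
  by rewrite -ge (gU f).
move=> k; rewrite finset.in_setD => /andP[kS kc] vk; case: (h k kc vk) => // ke.
by rewrite ke -ge gS in kS.
Qed.

(** At a vertex of degree two, agreement of [S] and [T] on one edge forces agreement on the other.
    Connectedness spreads this, so they agree on all edges or on none. *)
Lemma alternate_two c S T : circuit c -> alternate c S -> alternate c T ->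
  T = S \/ T = c :\: S.
Proof.
move=> [c1 c0 deg conn] /(alternateP _ c0)[Sc SO] /(alternateP _ c0)[Tc TO].
pose A v := forall e, e \in c -> v \in e -> (e \in S) = (e \in T).
have cov e v : e \in c -> v \in e -> v \in finset.cover c.
  by move=> ec ve; apply/bigcupP; exists e.
have agree e v : e \in c -> v \in e -> (e \in S) = (e \in T) -> A v.
  move=> ec ve eST f fc vf; have vc := cov e v ec ve.
  have [g1 [g2 [[g1c vg1] [g2c vg2] g12 hg]]] := deg v vc.
  have [s [sS vs] sU] := SO v vc; have [t [tT vt] tU] := TO v vc.
  have [->|/eqP fe] := eqVneq f e; first by [].
  have cor k : k \in c -> v \in k -> k = e \/ k = f.
    by move=> kc vk; case: (hg k kc vk) (hg e ec ve) (hg f fc vf) => -> [] e1 [] f1;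
      rewrite ?e1 ?f1; (by left) || (by right) || (case: fe; rewrite e1 f1).
  have [se|sf] := cor s (fintype.subsetP Sc _ sS) vs.
    have eT : e \in T by rewrite -eST -se.
    apply/idP/idP => h; case: fe; first by rewrite (sU f).
    by rewrite (tU f) // (tU e).
  have eS : e \notin S by apply/negP => eS; apply: fe; rewrite -sf; rewrite (sU e).
  have [te|tf] := cor t (fintype.subsetP Tc _ tT) vt.
    by move: eS; rewrite eST -te tT.
  by rewrite -{1}sf -tf sS tT.
have [[x [xc Ax]]|nA] := pselect (exists x, x \in finset.cover c /\ A x).
  left; have AA y : y \in finset.cover c -> A y.
    apply: (conn A x) => // e u v ec ue ve Au f.
    by apply: (agree e v ec ve); exact: Au.
  have nz e : e \in c -> exists v, v \in e.
    by move=> ec; apply/set0Pn; apply: contraNneq c0 => <-.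
  apply/finset.setP => e; have [ec|ec] := boolP (e \in c); last first.
    by rewrite (negPf (contra (fintype.subsetP Sc e) ec)) (negPf (contra (fintype.subsetP Tc e) ec)).
  by have [v ve] := nz e ec; rewrite (AA v) //; exact: cov ve.
right; apply/finset.setP => e; rewrite finset.in_setD.
have [ec|ec] := boolP (e \in c); last first.
  by rewrite andbF (negPf (contra (fintype.subsetP Tc e) ec)).
have [v ve] : exists v, v \in e by apply/set0Pn; apply: contraNneq c0 => <-.
rewrite andbT; apply: contrapT => ne; apply: nA; exists v; split; first exact: cov ve.
have eST : (e \in S) = (e \in T) by move: ne; case: (e \in S); case: (e \in T).
exact: (agree e v ec ve eST).
Qed.

End Exact.

Lemma next_ind_all (T : finType) (s : seq T) (Q : T -> Prop) x y :
  uniq s -> x \in s -> y \in s -> Q x -> (forall z, z \in s -> Q z -> Q (next s z)) -> Q y.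
Proof.
move=> us xs ys Qx h.
have xy : fconnect (next s) x y by rewrite (fconnect_cycle (cycle_next us) xs).
have it n : iter n (next s) x \in s /\ Q (iter n (next s) x).
  elim: n => [|n [IH1 IH2]] /=; first by [].
  by split; [rewrite mem_next|exact: h].
by rewrite -(iter_findex xy); case: (it (findex (next s) x y)).
Qed.

Lemma cycle_circuit (R : realType) (V : finType) (G : plane_graph R V)
  (C : {set {set V}}) : is_cycle G C -> circuit C.
Proof.
move=> [s [s2 /andP[cyc us] ->]].
set C' := finset.imset _ _.
have nadj x : x \in s -> adj G x (next s x) by exact: next_cycle.
have covE v : (v \in finset.cover C') = (v \in s).
  apply/bigcupP/idP => [[e /imsetP[x xs ->]]|vs].
    by rewrite in_set2 => /orP[] /eqP -> //; rewrite mem_next.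
  by exists [set v; next s v]; [apply/imsetP; exists v|rewrite in_set2 eqxx].
(* A return after two steps would leave only two vertices; length at least three thus keeps the two
   edges at a vertex distinct. *)
have nn v : v \in s -> next s (next s v) != v.
  move=> vs; apply: contraTneq s2 => nnv; rewrite -leqNgt.
  have sub : {subset s <= [:: v; next s v]}.
    move=> y ys; apply: (@next_ind_all _ s (fun y => y \in [:: v; next s v]) v y us vs ys); rewrite ?inE ?eqxx // => z _.
    by rewrite !inE => /orP[] /eqP ->; rewrite ?nnv eqxx ?orbT.
  exact: (uniq_leq_size us sub).
split.
- case: s s2 {cyc us nadj covE nn} @C' => // x s _ C'; apply/set0Pn.
  by exists [set x; next (x :: s) x]; apply/imsetP; exists x; rewrite ?inE ?eqxx.
- by apply/imsetP => -[x _ /eqP]; rewrite eq_sym => /eqP/finset.setP/(_ x); rewrite in_set2 eqxx inE.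
- move=> v; rewrite covE => vs.
  exists [set v; next s v], [set prev s v; next s (prev s v)].
  have ps : prev s v \in s by rewrite mem_prev.
  split.
  + by split; [apply/imsetP; exists v|rewrite in_set2 eqxx].
  + by split; [apply/imsetP; exists (prev s v)|rewrite in_set2 next_prev // eqxx orbT].
  + rewrite next_prev // => /finset.setP /(_ (next s v)); rewrite !in_set2 eqxx orbT.
    move=> /esym/orP[/eqP e|/eqP e].
      by have := nn (prev s v) ps; rewrite next_prev // e eqxx.
    by have := nadj v vs; rewrite e adj_irrefl.
  + move=> g /imsetP[x xs ->]; rewrite in_set2 => /orP[/eqP ->|/eqP vx]; first by left.
    by right; rewrite vx prev_next.
- move=> A x; rewrite covE => xs Ax h y; rewrite covE => ys.
  apply: (next_ind_all us xs ys Ax) => z zs; apply: (h [set z; next s z]).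
  + by apply/imsetP; exists z.
  + by rewrite in_set2 eqxx.
  + by rewrite in_set2 eqxx orbT.
Qed.

(** Each of the two terms on the right is at least 1, whereas a difference of indicators is at most
    1. *)
Lemma removed_twice (s t x y : int) (b : bool) : s = 1 \/ s = -1 -> t = 1 \/ t = -1 ->
  x * s < 0 -> y * t < 0 -> true%:Z - b%:Z <> - s * x + (- t * y + 0).
Proof. by case=> -> [] ->; case: b => /= h1 h2; lia. Qed.

(** * Heights of the matchings reachable from a base matching *)

Section Flips.
Variables (V : finType) (E : {set {set V}}) (CC : {set {set {set V}}}).
Hypothesis E0 : finset.set0 \notin E.
Hypothesis CC_circuit : forall c, c \in CC -> circuit c.
Hypothesis CC_edges : forall c, c \in CC -> c \subset E.
Hypothesis CC_two : forall e c1 c2 c3, c1 \in CC -> c2 \in CC -> c3 \in CC ->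
  e \in c1 -> e \in c2 -> e \in c3 ->
  c1 != c2 -> c1 != c3 -> c2 != c3 -> False.
Hypothesis CC_private : forall (S : {set {set {set V}}}) c0, c0 \in S ->
  (forall c, c \in S -> c \in CC) ->
  exists e c, [/\ c \in S, e \in c & forall c', c' \in S -> e \in c' -> c' = c].
Implicit Types (M N S c d : {set {set V}}) (e f : {set V}) (J : {set {set {set V}}}).

Definition pm M : Prop := M \subset E /\ forall v, covers_once M v.

Definition flip M c := (M :\: c) :|: (c :\: M).

Definition flippable M c := alternate c (M :&: c).

Lemma in_flip M c e : (e \in flip M c) = (e \in M) (+) (e \in c).
Proof. by rewrite finset.in_setU !finset.in_setD; case: (e \in M); case: (e \in c). Qed.

Lemma flipK M c : flip (flip M c) c = M.
Proof. by apply/finset.setP => e; rewrite !in_flip -addbA addbb addbF. Qed.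

Lemma flipAC M c d : flip (flip M c) d = flip (flip M d) c.
Proof. by apply/finset.setP => e; rewrite !in_flip addbAC. Qed.

Lemma flip_cap M c : flip M c :&: c = c :\: (M :&: c).
Proof.
apply/finset.setP => e; rewrite !(finset.in_setI, in_flip, finset.in_setD).
by case: (e \in M); case: (e \in c).
Qed.

Lemma CC_set0 c : c \in CC -> finset.set0 \notin c.
Proof. by move=> /CC_circuit[]. Qed.

Lemma CC_edge c : c \in CC -> exists e, e \in c.
Proof. by move=> /CC_circuit[/set0Pn]. Qed.

Lemma CC_vertex c e : c \in CC -> e \in c -> exists v, v \in e.
Proof. by move=> /CC_set0 c0 ec; apply/set0Pn; apply: contraNneq c0 => <-. Qed.

Lemma flippable_flip M c : c \in CC -> flippable M c -> flippable (flip M c) c.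
Proof. by move=> cC fM; rewrite /flippable flip_cap; apply: alternate_compl => //; exact: CC_circuit. Qed.

Lemma in_cover c e v : e \in c -> v \in e -> v \in finset.cover c.
Proof. by move=> ec ve; apply/bigcupP; exists e. Qed.

Lemma flippable_once M c v : c \in CC -> flippable M c -> v \in finset.cover c ->
  exists2 e, [/\ e \in M, e \in c & v \in e] & forall f, f \in M -> f \in c -> v \in f -> f = e.
Proof.
move=> cC /(alternateP _ (CC_set0 cC))[_ h] vc; have [e [+ ve] eU] := h v vc.
rewrite finset.in_setI => /andP[eM ec]; exists e => // f fM fc vf.
by apply: eU => //; rewrite finset.in_setI fM.
Qed.

(** At a vertex of [c] the matching edge lies on [c] and is exchanged for the other edge of [c]; at
    all other vertices nothing changes. *)
Lemma pm_flip M c : c \in CC -> flippable M c -> pm M -> pm (flip M c).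
Proof.
move=> cC fM [ME MO]; split.
  apply/fintype.subsetP => e; rewrite finset.in_setU !finset.in_setD.
  by case/orP => /andP[_]; [exact: (fintype.subsetP ME)|exact: (fintype.subsetP (CC_edges cC))].
move=> v; have [vc|vc] := boolP (v \in finset.cover c).
  have [e [eN ec ve] eU] := flippable_once cC (flippable_flip cC fM) vc.
  exists e => // f fN vf; apply: eU => //; move: fN; rewrite in_flip.
  case fc: (f \in c) => //; rewrite addbF => fM'.
  have [g [gM gc vg] _] := flippable_once cC fM vc.
  by rewrite -fc (covers_once_uniq (MO v) fM' gM vf vg).
have nc f : v \in f -> f \in c = false.
  by move=> vf; apply: contraNF vc => fc; exact: in_cover vf.
have [e [eM ve] eU] := MO v; exists e; first by rewrite in_flip eM nc.
by move=> f; rewrite in_flip => + vf; rewrite nc // addbF => /eU; apply.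
Qed.

Definition vdisjoint c d := [disjoint finset.cover c & finset.cover d].

Lemma vdisjointF c d v : vdisjoint c d -> v \in finset.cover c -> v \in finset.cover d -> False.
Proof. by move=> /disjointFr h /h ->. Qed.

Lemma vdisjoint_edge c d e : c \in CC -> vdisjoint c d -> e \in c -> e \in d = false.
Proof.
move=> cC cd ec; apply/negP => ed; have [v ve] := CC_vertex cC ec.
by apply: (vdisjointF cd (in_cover ec ve)); exact: in_cover ve.
Qed.

Lemma flip_cap_disj M c d : c \in CC -> vdisjoint c d -> flip M c :&: d = M :&: d.
Proof.
move=> cC cd; apply/finset.setP => e; rewrite !finset.in_setI in_flip.
have [ec|] := boolP (e \in c); last by rewrite addbF.
by rewrite (vdisjoint_edge cC cd ec) !andbF.
Qed.

Lemma flippable_disj M c d : c \in CC -> vdisjoint c d ->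
  flippable (flip M c) d = flippable M d.
Proof. by move=> cC cd; rewrite /flippable flip_cap_disj. Qed.

(** An arbitrary half of [c] that fixes the sign of its height. The default does not occur once [c]
    is flippable in some [M], since [M :&: c] is then a candidate. *)
Definition ref c : {set {set V}} := odflt finset.set0 [pick S | alternate c S].

Definition eps e c : int := if e \in c then (if e \in ref c then 1 else -1) else 0.

(** The change of height of [c] under a flip: [-1] if the reference half is taken out, [1] if it is
    brought in. *)
Definition sgn M c : int := if M :&: c == ref c then -1 else 1.

Lemma sgn_disj M c d : c \in CC -> vdisjoint c d -> sgn (flip M c) d = sgn M d.
Proof. by move=> cC cd; rewrite /sgn flip_cap_disj. Qed.

Lemma sgn_unit M c : sgn M c = 1 \/ sgn M c = -1.
Proof. by rewrite /sgn; case: ifP; [right|left]. Qed.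

Lemma eps_unit e c : e \in c -> eps e c = 1 \/ eps e c = -1.
Proof. by rewrite /eps => ->; case: ifP; [left|right]. Qed.

Lemma flip_eps M c e : c \in CC -> flippable M c ->
  (e \in flip M c)%:Z - (e \in M)%:Z = eps e c * sgn M c.
Proof.
move=> cC fM; rewrite in_flip /eps.
have [ec|ec] := boolP (e \in c); last by rewrite addbF subrr mul0r.
have altr : alternate c (ref c).
  by rewrite /ref; case: pickP => [S //|/(_ (M :&: c))]; rewrite -/(flippable M c) fM.
have eMc : (e \in M :&: c) = (e \in M) by rewrite finset.in_setI ec andbT.
rewrite /sgn; have [Mr|nMr] := eqVneq (M :&: c) (ref c).
  by rewrite -Mr eMc; case: (e \in M).
have [/eqP|h] := alternate_two (CC_circuit cC) altr fM; first by rewrite (negPf nMr).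
by rewrite -eMc h finset.in_setD ec andbT; case: (e \in ref c).
Qed.

Lemma sgn_flip M c : c \in CC -> flippable M c -> sgn (flip M c) c = - sgn M c.
Proof.
move=> cC fM; have [e ec] := CC_edge cC.
have := flip_eps e cC fM; have := flip_eps e cC (flippable_flip cC fM).
rewrite flipK; move: (sgn M c) (sgn (flip M c) c) => s s'.
by case: (eps_unit ec) => ->; case: (e \in M); case: (e \in flip M c) => /= h1 h2; lia.
Qed.

Lemma eps_removed M c e : c \in CC -> flippable M c -> e \in M -> e \in c ->
  eps e c = - sgn M c.
Proof.
move=> cC fM eM ec; have := flip_eps e cC fM; rewrite in_flip eM ec /=.
by case: (eps_unit ec) => ->; lia.
Qed.

Notation height := {ffun {set {set V}} -> int}.
Implicit Type h : height.

Definition bump M h c : height := [ffun d => h d + (if d == c then sgn M c else 0)].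

Variable M0 : {set {set V}}.
Hypothesis pm0 : pm M0.

(** The sign condition says that the step enlarges the absolute height of [c], so these are the
    paths from [M0] along which no height ever moves back to 0. *)
Inductive outward : {set {set V}} -> height -> Prop :=
| outward0 : outward M0 [ffun=> 0]
| outwardS M h c : outward M h -> c \in CC -> flippable M c -> 0 <= h c * sgn M c ->
    outward (flip M c) (bump M h c).

Lemma outward_pm M h : outward M h -> pm M.
Proof. by elim=> // {M h}- M h c _ IH cC fM _; exact: pm_flip. Qed.

Lemma outward_eq M h : outward M h ->
  forall e, (e \in M)%:Z - (e \in M0)%:Z = \sum_(c in CC) eps e c * h c.
Proof.
elim=> [e|{M h}- M h c _ IH cC fM _ e].
  by rewrite subrr big1 // => c _; rewrite ffunE mulr0.
under eq_bigr => d _ do rewrite ffunE mulrDr.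
rewrite big_split /= -IH (bigD1 c) //= eqxx -flip_eps // big1; last first.
  by move=> d /andP[_ /negPf ->]; rewrite mulr0.
by rewrite addr0 addrC addrA subrK.
Qed.

Lemma outward_out M h c : outward M h -> c \notin CC -> h c = 0.
Proof.
elim=> [|{M h}- M h d _ IH dC _ _] cC; rewrite ffunE // IH // add0r.
by case: eqP => // cd; rewrite cd dC in cC.
Qed.

(** The cycles on which two heights differ would form a family with an edge on exactly one of them;
    at that edge a single nonzero term would remain in the difference of the two instances of
    [outward_eq]. *)
Lemma outward_uniq M h h' : outward M h -> outward M h' -> h = h'.
Proof.
move=> oh oh'; apply/ffunP => c; have [cC|cC] := boolP (c \in CC); last first.
  by rewrite (outward_out oh) // (outward_out oh').
apply/eqP; apply: contrapT => /negP ne.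
pose S := [set d in CC | h d != h' d].
have [||e [b [bS eb bU]]] := @CC_private S c; first by rewrite inE cC.
  by move=> d; rewrite inE => /andP[].
have := outward_eq oh e; rewrite (outward_eq oh' e) => /eqP; rewrite -subr_eq0 -sumrB.
move: bS; rewrite inE => /andP[bC hb].
rewrite (bigD1 b) //= big1; last first.
  move=> d /andP[dC db]; rewrite -mulrBr.
  have [->|hd] := eqVneq (h d) (h' d); first by rewrite subrr mulr0.
  have [ed|ed] := boolP (e \in d); last by rewrite /eps (negPf ed) mul0r.
  by rewrite (bU d) ?inE ?dC ?eqxx // in db.
move: hb; case: (eps_unit eb) => ->; lia.
Qed.

(** At a shared vertex the matching edge lies on both cycles, and by [CC_two] on no third. In
    [outward_eq] both cycles then contribute at least 1, which [removed_twice] excludes. *)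
Lemma toward_disjoint M h c d : outward M h -> c \in CC -> d \in CC -> c != d ->
  flippable M c -> flippable M d -> h c * sgn M c < 0 -> h d * sgn M d < 0 ->
  vdisjoint c d.
Proof.
move=> oh cC dC cd fc fd tc td; apply: contraT => /pred0Pn[v /= /andP[vc vd]].
have [e [eM ec ve] _] := flippable_once cC fc vc.
have [f [fM fd' vf] _] := flippable_once dC fd vd.
have ef : e = f by have [_ MO] := outward_pm oh; exact: (covers_once_uniq (MO v)).
have ed : e \in d by rewrite ef.
have := outward_eq oh e.
rewrite (bigD1 c) //= (bigD1 d) /=; last by rewrite dC eq_sym.
rewrite big1; last first.
  move=> b /andP[/andP[bC bc] bd]; rewrite /eps; case: ifP => [eb|_]; last by rewrite mul0r.
  by exfalso; apply: (CC_two cC dC bC ec ed eb) => //; rewrite eq_sym.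
rewrite (eps_removed cC fc eM ec) (eps_removed dC fd eM ed) eM.
by move=> h1; case: (removed_twice (sgn_unit M c) (sgn_unit M d) tc td h1).
Qed.

Lemma bump_toward M h c : c \in CC -> flippable M c -> 0 <= h c * sgn M c ->
  bump M h c c * sgn (flip M c) c < 0.
Proof.
move=> cC fM; rewrite ffunE eqxx sgn_flip //.
by case: (sgn_unit M c) => ->; lia.
Qed.

Lemma bumpK M h c : c \in CC -> flippable M c -> bump (flip M c) (bump M h c) c = h.
Proof.
move=> cC fM; apply/ffunP => d; rewrite !ffunE; case: eqP => [->|_]; last by rewrite !addr0.
by rewrite sgn_flip //; ring.
Qed.

(* An outward step followed by an inward one either cancels or commutes. *)
Lemma outward_inward M h : outward M h -> forall d, d \in CC -> flippable M d ->
  h d * sgn M d < 0 -> outward (flip M d) (bump M h d).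
Proof.
elim=> [d _ _|{M h}- M h c oh IH cC fM ac d dC fd td].
  by rewrite ffunE mul0r ltxx.
have [->|dc] := eqVneq d c; first by rewrite flipK bumpK.
have cd : vdisjoint c d.
  apply: (toward_disjoint (outwardS oh cC fM ac)) => //; first by rewrite eq_sym.
    exact: flippable_flip.
  exact: bump_toward.
have dc' : vdisjoint d c by rewrite /vdisjoint disjoint_sym.
move: fd td; rewrite flippable_disj // sgn_disj // ffunE (negPf dc) addr0 => fd td.
have o2 := IH d dC fd td.
rewrite flipAC (_ : bump _ _ d = bump (flip M d) (bump M h d) c); last first.
  by apply/ffunP => b; rewrite !ffunE !sgn_disj // addrAC.
apply: outwardS => //; first by rewrite flippable_disj.
by rewrite sgn_disj // ffunE eq_sym (negPf dc) addr0.
Qed.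

Definition reachable M : Prop := exists h, outward M h.

(** The choice is forced by [outward_uniq]; the zero function is only the default for unreachable
    [M]. *)
Definition hgt M : height := xget [ffun=> 0] [set h | outward M h]%classic.

Lemma hgt_outward M : reachable M -> outward M (hgt M).
Proof. by move=> [h oh]; rewrite /hgt; case: xgetP => [g -> //|/(_ h)]. Qed.

Lemma hgtE M h : outward M h -> hgt M = h.
Proof. by move=> oh; apply: (outward_uniq (hgt_outward _) oh); exists h. Qed.

Lemma reachable_pm M : reachable M -> pm M.
Proof. by move=> [h]; exact: outward_pm. Qed.

Lemma reachable0 : reachable M0. Proof. by exists [ffun=> 0]; exact: outward0. Qed.

Definition inward M : {set {set {set V}}} :=
  [set c in CC | flippable M c && (hgt M c * sgn M c < 0)].

Lemma inwardP M c : reflect [/\ c \in CC, flippable M c & hgt M c * sgn M c < 0] (c \in inward M).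
Proof. by rewrite inE; apply: and3P. Qed.

(** Makes outward reachability closed under all flips, the inward ones being handled by
    [outward_inward]. *)
Lemma flip_outward M c : reachable M -> c \in CC -> flippable M c ->
  outward (flip M c) (bump M (hgt M) c).
Proof.
move=> /hgt_outward oh cC fM; have [tc|ac] := ltP (hgt M c * sgn M c) 0.
  exact: outward_inward.
exact: outwardS.
Qed.

Lemma reachable_flip M c : reachable M -> c \in CC -> flippable M c -> reachable (flip M c).
Proof. by move=> cM cC fM; exists (bump M (hgt M) c); exact: flip_outward. Qed.

Lemma hgt_flip M c : reachable M -> c \in CC -> flippable M c ->
  hgt (flip M c) = bump M (hgt M) c.
Proof. by move=> cM cC fM; apply: hgtE; exact: flip_outward. Qed.

Lemma inward_disjoint M c d : reachable M -> c \in inward M -> d \in inward M -> c != d ->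
  vdisjoint c d.
Proof.
move=> /hgt_outward oh /inwardP[cC fc tc] /inwardP[dC fd td] cd.
exact: (toward_disjoint oh).
Qed.

(** The cycle of the last outward step can be flipped back. *)
Lemma inward_neq0 M : reachable M -> M <> M0 -> exists c, c \in inward M.
Proof.
move=> /hgt_outward oh; elim: oh => // {}M h c oh _ cC fM ac _.
exists c; apply/inwardP; split=> //; first exact: flippable_flip.
rewrite hgt_flip //; last by exists h.
by rewrite (hgtE oh); exact: bump_toward.
Qed.

Lemma inward_flip_disj M c d : reachable M -> c \in CC -> flippable M c -> vdisjoint c d ->
  d != c -> (d \in inward (flip M c)) = (d \in inward M).
Proof.
move=> cM cC fM cd dc; rewrite !inE flippable_disj // sgn_disj // hgt_flip // ffunE.
by rewrite (negPf dc) addr0.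
Qed.

Lemma inward_flip M c : reachable M -> c \in CC -> flippable M c ->
  (c \in inward (flip M c)) = (c \notin inward M).
Proof.
move=> cM cC fM; rewrite !inE cC /= flippable_flip // fM hgt_flip // ffunE eqxx sgn_flip //=.
rewrite -leNgt; case: (sgn_unit M c) => ->; lia.
Qed.

(** Total absolute height, which every inward flip decreases; it orders the collapses. *)
Definition rank M : nat := (\sum_(c in CC) `|hgt M c|)%N.

Lemma rank_flip M c : reachable M -> c \in inward M -> (rank (flip M c) < rank M)%N.
Proof.
move=> cM /inwardP[cC fM tc]; rewrite /rank (bigD1 c) //= [in ltnRHS](bigD1 c) //=.
rewrite hgt_flip // (eq_bigr (fun d => `|hgt M d|%N)); last first.
  by move=> d /andP[_ /negPf dc]; rewrite ffunE dc addr0.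
rewrite ltn_add2r ffunE eqxx; move: tc; case: (sgn_unit M c) => ->; lia.
Qed.

(** A cube presented by a corner [M] and its directions [J]; by [valid_flip] any other corner can
    serve. *)
Definition valid M J : Prop :=
  [/\ pm M, forall c, c \in J -> c \in CC /\ flippable M c &
      {in J &, forall c d, c != d -> vdisjoint c d}].

Lemma valid_flip M J c : valid M J -> c \in J -> valid (flip M c) J.
Proof.
move=> [pM cJ dJ] cin; have [cC fM] := cJ c cin; split=> //; first exact: pm_flip.
move=> d dJ'; have [dC fd] := cJ d dJ'; split=> //.
have [->|dc] := eqVneq d c; first exact: flippable_flip.
by rewrite flippable_disj // dJ // eq_sym.
Qed.

Lemma valid_inward M : reachable M -> valid M (inward M).
Proof.
move=> cM; split; first exact: reachable_pm.
  by move=> c /inwardP[].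
by move=> c d cI dI cd; exact: (inward_disjoint cM cI dI cd).
Qed.

Lemma pm_sub_eq M N : pm M -> pm N -> N \subset M -> N = M.
Proof.
move=> [ME MO] [NE NO] NM; apply/eqP; rewrite finset.eqEsubset NM /=.
apply/fintype.subsetP => e eM.
have [v ve] : exists v, v \in e.
  by apply/set0Pn; apply: contraNneq E0 => <-; exact: (fintype.subsetP ME).
have [f [fN vf] _] := NO v.
by rewrite (covers_once_uniq (MO v) eM (fintype.subsetP NM _ fN) ve vf).
Qed.

Lemma valid_cap M N J c : valid M J -> pm N -> N \subset M :|: finset.cover J ->
  c \in J -> flippable N c.
Proof.
move=> [[ME MO] cJ dJ] [NE NO] NMJ cin; have [cC fM] := cJ c cin.
apply/(alternateP _ (CC_set0 cC)); split; first exact: finset.subsetIr.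
move=> v vc; have [e [eN ve] eU] := NO v.
have ec : e \in c.
  have := fintype.subsetP NMJ _ eN; rewrite finset.in_setU => /orP[eM|].
    have [f [fM' fc vf] _] := flippable_once cC fM vc.
    by rewrite (covers_once_uniq (MO v) eM fM' ve vf).
  move=> /bigcupP[d dJ' ed]; have [->//|cd] := eqVneq c d.
  by case: (vdisjointF (dJ c d cin dJ' cd) vc (in_cover ed ve)).
exists e; first by rewrite finset.in_setI eN ec.
by move=> f; rewrite finset.in_setI => /andP[fN _]; exact: eU.
Qed.

Lemma flip_agree M N c : c \in CC -> flippable M c -> flippable N c ->
  N :&: c != M :&: c -> N :&: c = flip M c :&: c.
Proof.
move=> cC fM fN; have [->|-> _] := alternate_two (CC_circuit cC) fM fN; first by rewrite eqxx.
by rewrite flip_cap.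
Qed.

(** Walks from corner [M] to corner [N] of one cube, flipping each cycle on which they differ. *)
Lemma valid_ind (Pr : {set {set V}} -> Prop) M N J :
  valid M J -> pm N -> N \subset M :|: finset.cover J ->
  (forall M' c, valid M' J -> c \in J -> N :&: c != M' :&: c -> Pr M' -> Pr (flip M' c)) ->
  Pr M -> Pr N.
Proof.
move=> vM pN + step.
have [n] := ubnP #|[set c in J | N :&: c != M :&: c]|.
elim: n M vM => // n IH M vM; rewrite ltnS => leN NMJ QM.
have [pM cJ dJ] := vM.
have [/eqP S0|/set0Pn[c]] := boolP ([set c in J | N :&: c != M :&: c] == finset.set0).
  suff -> : N = M by [].
  apply: pm_sub_eq => //; apply/fintype.subsetP => e eN.
  have := fintype.subsetP NMJ _ eN; rewrite finset.in_setU => /orP[//|].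
  move=> /bigcupP[c cin ec]; have /finset.setP /(_ c) := S0.
  rewrite !inE cin /= => /negbFE /eqP /finset.setP /(_ e).
  by rewrite !finset.in_setI eN ec !andbT.
rewrite inE => /andP[cin nc]; have [cC fM] := cJ c cin.
apply: (IH (flip M c)); first exact: valid_flip.
- apply: leq_trans leN; apply: proper_card; apply/properP; split.
    apply/fintype.subsetP => d; rewrite !inE => /andP[dJ' nd]; rewrite dJ' /=.
    have [dc|dc] := eqVneq d c.
      by rewrite dc.
    by move: nd; rewrite flip_cap_disj // dJ // eq_sym.
  exists c; rewrite !inE cin //= negbK; apply/eqP; apply: flip_agree => //.
  exact: (valid_cap vM).
- apply/fintype.subsetP => e eN; have := fintype.subsetP NMJ _ eN.
  rewrite !finset.in_setU => /orP[eM|->]; last by rewrite orbT.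
  have [ec|ec] := boolP (e \in c); last by rewrite finset.in_setD ec eM.
  by apply/orP; right; apply/bigcupP; exists c.
- exact: step.
Qed.

Lemma reachable_valid M N J : reachable M -> valid M J -> pm N ->
  N \subset M :|: finset.cover J -> reachable N.
Proof.
move=> cM vM pN NMJ; apply: (valid_ind vM pN NMJ) => // M' c [_ cJ _] cin _ cM'.
by have [cC fM'] := cJ c cin; exact: reachable_flip.
Qed.

(** The walk from the top corner [M] to [N] uses inward flips only: flipping one cycle does not
    affect whether a disjoint one is inward. Hence a set closed under inward flips contains all
    corners of such a cube. *)
Lemma inward_closed_valid (D : {set {set {set V}}}) M N :
  (forall M', M' \in D -> reachable M') ->
  (forall M' c, M' \in D -> c \in inward M' -> flip M' c \in D) ->
  M \in D -> pm N -> N \subset M :|: finset.cover (inward M) -> N \in D.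
Proof.
move=> Dcls Ddown MD pN NM; have cM := Dcls M MD.
have vM := valid_inward cM.
(* The second clause is vacuous at [N]; along the walk it is the invariant that cycles still to be
   flipped are still inward. *)
suff [] : N \in D /\ forall d, d \in inward M -> N :&: d != N :&: d -> d \in inward N by [].
apply: (@valid_ind (fun M' => M' \in D /\ forall d, d \in inward M ->
    N :&: d != M' :&: d -> d \in inward M') M N (inward M)) => //.
move=> M' c vM' cin nc [M'D h]; have cI := h c cin nc.
have cM' := Dcls _ M'D.
have [pM' cJ dJ] := vM'; have [cC fM'] := cJ c cin.
split=> [|d din nd]; first exact: Ddown.
have [dc|dc] := eqVneq d c.
  move: nd; rewrite dc -(@flip_agree M' N c) ?eqxx //.
  exact: (valid_cap vM).
have cd : vdisjoint c d by apply: dJ => //; rewrite eq_sym.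
by rewrite inward_flip_disj //; apply: h => //; rewrite -(flip_cap_disj M' cC cd).
Qed.

(* Turning every cycle of [J] outward leads to the top vertex of a cube. *)
Lemma valid_top (Pr : {set {set V}} -> Prop) M J : reachable M -> valid M J -> Pr M ->
  (forall M' c, valid M' J -> c \in J -> Pr M' -> Pr (flip M' c)) ->
  exists N, [/\ reachable N, valid N J, J \subset inward N & Pr N].
Proof.
move=> + + + step; have [n] := ubnP #|J :\: inward M|.
elim: n M => // n IH M; rewrite ltnS => leN cM vM QM.
have [S0|/set0Pn[c]] := boolP (J :\: inward M == finset.set0).
  by exists M; split=> //; rewrite -finset.setD_eq0.
rewrite finset.in_setD => /andP[cI cin]; have [pM cJ dJ] := vM; have [cC fM] := cJ c cin.
apply: (IH (flip M c)); [|exact: reachable_flip|exact: valid_flip|exact: step].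
apply: leq_trans leN; apply: proper_card; apply/properP; split.
  apply/fintype.subsetP => d; rewrite !finset.in_setD => /andP[nd din]; rewrite din andbT.
  have [->//|dc] := eqVneq d c.
  by move: nd; rewrite inward_flip_disj // dJ // eq_sym.
by exists c; rewrite !finset.in_setD cin andbT // negbK inward_flip.
Qed.

(** * The cubes of the complex *)

Section Cubes.
Variable R : realType.
Local Notation W := 'rV[R]_#|{set V}|.
Implicit Types (w : W) (s : {set {set V}} -> R).

Definition weight w e : R := w ord0 (enum_rank e).

Lemma weight_ind S e : weight (edge_ind R S) e = (e \in S)%:R.
Proof. by rewrite /weight mxE enum_rankK. Qed.

Lemma weightD w w' e : weight (w + w') e = weight w e + weight w' e.
Proof. by rewrite /weight mxE. Qed.

Lemma weightB w w' e : weight (w - w') e = weight w e - weight w' e.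
Proof. by rewrite /weight !mxE. Qed.

Lemma weightZ (a : R) w e : weight (a *: w) e = a * weight w e.
Proof. by rewrite /weight mxE. Qed.

Lemma weight_sum (J : {set {set {set V}}}) (f : {set {set V}} -> W) e :
  weight (\sum_(c in J) f c) e = \sum_(c in J) weight (f c) e.
Proof. by rewrite /weight summxE. Qed.

Lemma weightP w w' : (forall e, weight w e = weight w' e) -> w = w'.
Proof.
move=> h; apply/rowP => i; have := h (enum_val i).
by rewrite /weight enum_valK.
Qed.

(** The edge vector from [M] to [flip M c]; in [mcube_pt] the coordinate [s c] is the fraction of
    the flip carried out. *)
Definition turn M c : W := edge_ind R (c :\: M) - edge_ind R (M :&: c).

Lemma weight_turn M c e : weight (turn M c) e =
  if e \in c then (if e \in M then -1 else 1) else 0.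
Proof.
rewrite weightB !weight_ind finset.in_setD finset.in_setI.
by case: (e \in c); case: (e \in M); rewrite /= ?subr0 ?sub0r ?subrr.
Qed.

Definition mcube_pt M J s : W := edge_ind R M + \sum_(c in J) s c *: turn M c.

Definition mcube M J : set W :=
  [set w | exists2 s, forall c, c \in J -> 0 <= s c <= 1 & w = mcube_pt M J s]%classic.

Lemma ind_flip M c : edge_ind R (flip M c) = edge_ind R M + turn M c.
Proof.
apply: weightP => e; rewrite weightD !weight_ind weight_turn in_flip.
by case: (e \in M); case: (e \in c); rewrite /= ?addr0 ?add0r ?subrr.
Qed.

Lemma turn_flip M c : turn (flip M c) c = - turn M c.
Proof.
apply: weightP => e; rewrite -[- _]scaleN1r weightZ !weight_turn in_flip.
by case: (e \in M); case: (e \in c); rewrite /= ?mulr0 ?mulN1r ?opprK.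
Qed.

Lemma turn_flip_disj M c d : c \in CC -> vdisjoint c d -> turn (flip M c) d = turn M d.
Proof.
move=> cC cd; apply: weightP => e; rewrite !weight_turn in_flip.
have [ed|//] := boolP (e \in d); have [ec|] := boolP (e \in c); last by rewrite addbF.
by rewrite (vdisjoint_edge cC cd ec) in ed.
Qed.

(** Crossing to the other corner along [c] reverses that edge vector and turns [s c] into
    [1 - s c]. *)
Lemma mcube_pt_flip M J s c : valid M J -> c \in J ->
  mcube_pt M J s = mcube_pt (flip M c) J (fun d => if d == c then 1 - s c else s d).
Proof.
move=> [_ cJ dJ] cin; have [cC _] := cJ c cin.
rewrite /mcube_pt (bigD1 c) //= [in RHS](bigD1 c) //= eqxx turn_flip ind_flip.
rewrite [in RHS](eq_bigr (fun d => s d *: turn M d)); last first.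
  move=> d /andP[dJ' dc]; rewrite (negPf dc) turn_flip_disj // dJ // 1?eq_sym //.
by rewrite scalerN scalerBl scale1r opprB [RHS]addrA [X in _ = X + _]addrACA subrr addr0 addrA.
Qed.

Lemma mcube_flip M J c w : valid M J -> c \in J -> mcube M J w -> mcube (flip M c) J w.
Proof.
move=> vM cin [s s01 ->]; exists (fun d => if d == c then 1 - s c else s d); last exact: mcube_pt_flip.
move=> d dJ; case: eqP => _; last exact: s01.
by have /andP[s0 s1] := s01 c cin; rewrite subr_ge0 s1 gerBl.
Qed.

Lemma mcube_pt_widen M J J' s : J' \subset J -> (forall c, c \in J -> c \notin J' -> s c = 0) ->
  mcube_pt M J s = mcube_pt M J' s.
Proof.
move=> JJ s0; rewrite /mcube_pt; congr (_ + _).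
rewrite (big_setID J') /= (finset.setIidPr JJ) [X in _ + X]big1 ?addr0 // => c.
by rewrite finset.in_setD => /andP[cJ' cJ]; rewrite s0 // scale0r.
Qed.

Lemma mcube_widen M J J' w : J' \subset J -> mcube M J' w -> mcube M J w.
Proof.
move=> JJ [s s01 ->]; exists (fun c => if c \in J' then s c else 0).
  by move=> c _; case: ifP => [/s01 //|_]; rewrite lexx ler01.
rewrite (@mcube_pt_widen _ _ J') //; last by move=> c _ /negPf ->.
by rewrite /mcube_pt; congr (_ + _); apply: eq_bigr => c ->.
Qed.

Lemma weight_pt_in M J s c e : valid M J -> c \in J -> e \in c ->
  weight (mcube_pt M J s) e = if e \in M then 1 - s c else s c.
Proof.
move=> [_ cJ dJ] cin ec; rewrite /mcube_pt weightD weight_sum weight_ind (bigD1 c) //= big1 => [|d /andP[dJ' dc]].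
  by rewrite addr0 weightZ weight_turn ec; case: (e \in M); rewrite /= ?mulrN1 ?mulr1 ?add0r.
have [cC _] := cJ c cin.
by rewrite weightZ weight_turn (vdisjoint_edge cC _ ec) ?mulr0 // dJ // eq_sym.
Qed.

Lemma weight_pt_out M J s e : e \notin finset.cover J -> weight (mcube_pt M J s) e = (e \in M)%:R.
Proof.
move=> eJ; rewrite /mcube_pt weightD weight_sum weight_ind big1 ?addr0 // => c cin.
rewrite weightZ weight_turn; case: ifP => [ec|_]; last by rewrite mulr0.
by case/negP: eJ; apply/bigcupP; exists c.
Qed.

Definition positive_on N w : Prop := forall e, e \in N -> 0 < weight w e.

Lemma positive_on_sub M J N w : mcube M J w -> positive_on N w ->
  N \subset M :|: finset.cover J.
Proof.
move=> [s s01 ->] h; apply/fintype.subsetP => e /h; rewrite finset.in_setU.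
have [_|eJ] := boolP (e \in finset.cover J); first by rewrite orbT.
by rewrite weight_pt_out // orbF; case: (e \in M) => //; rewrite ltxx.
Qed.

(** Flipping the cycles with coordinate 1 brings all coordinates below 1, and then every edge of the
    new corner has positive weight. *)
Lemma mcube_positive M J w : valid M J -> mcube M J w ->
  exists N, [/\ valid N J, mcube N J w, positive_on N w & M \subset N :|: finset.cover J].
Proof.
move=> vM [s]; have [n] := ubnP #|[set c in J | s c == 1]|.
elim: n M s vM => // n IH M s vM; rewrite ltnS => leN s01 wE.
have [/eqP S0|/set0Pn[c]] := boolP ([set c in J | s c == 1] == finset.set0).
  exists M; split=> //; [by exists s| |exact: finset.subsetUl].
  move=> e eM; rewrite wE.
  have [/bigcupP[c cin ec]|eJ] := boolP (e \in finset.cover J); last first.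
    by rewrite weight_pt_out // eM ltr01.
  rewrite (weight_pt_in _ vM cin ec) eM subr_gt0 lt_def; have /andP[_ ->] := s01 c cin.
  have /finset.setP /(_ c) := S0; rewrite !inE cin /= eq_sym => /negbT ->.
  by [].
rewrite inE => /andP[cin /eqP s1].
have [| | | |N [h1 h2 h3 h4]] := IH (flip M c) (fun d => if d == c then 1 - s c else s d).
- exact: valid_flip.
- apply: leq_trans leN; apply: proper_card; apply/properP; split.
    apply/fintype.subsetP => d; rewrite !inE => /andP[-> /=]; case: (d =P c) => [->|//] _.
    by rewrite s1 eqxx.
  by exists c; rewrite !inE cin ?s1 //= eqxx subrr eq_sym oner_eq0.
- move=> d dJ; case: eqP => _; last exact: s01.
  by rewrite s1 subrr lexx ler01.
- by rewrite -mcube_pt_flip.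
- exists N; split=> //; apply/fintype.subsetP => e eM; rewrite finset.in_setU.
  have [ec|ec] := boolP (e \in c); first by apply/orP; right; apply/bigcupP; exists c.
  by rewrite -finset.in_setU; apply: (fintype.subsetP h4); rewrite in_flip eM (negPf ec).
Qed.

Lemma mcube_compact M J : compact (mcube M J).
Proof.
(* Coordinates are indexed by all edge sets so that the cube is the image of a product of intervals;
   those outside [J] have no effect. *)
pose g (v : 'rV[R]_#|{set {set V}}|) : W :=
  edge_ind R M + \sum_(c in J) v ord0 (enum_rank c) *: turn M c.
pose A := [set v : 'rV[R]_#|{set {set V}}| | forall i, `[0, 1]%classic (v ord0 i)]%classic.
rewrite (_ : mcube M J = [set g v | v in A]%classic).
  apply: continuous_compact; last first.
    by apply: (@rV_compact R _ (fun=> `[0, 1]%classic)) => i; exact: segment_compact.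
  apply: continuous_subspaceT; rewrite /g => v.
  apply: (@cvgD R W _ (nbhs v) _ (fun=> edge_ind R M)
    (fun u => \sum_(c in J) u ord0 (enum_rank c) *: turn M c)); first exact: cvg_cst.
  apply: (@cvg_big W _ +%R); first exact: add_continuous.
  move=> c _; apply: (@cvgZ R W _ (nbhs v) _ (fun u => u ord0 (enum_rank c)) (fun=> turn M c)).
    exact: coord_continuous.
  exact: cvg_cst.
apply/seteqP; split=> w.
  move=> [s s01 ->]; exists (\row_i (if enum_val i \in J then s (enum_val i) else 0)).
    move=> i; rewrite /= in_itv /= mxE; case: ifP => [/s01 //|_]; by rewrite lexx ler01.
  rewrite /g /mcube_pt; congr (_ + _); apply: eq_bigr => c cin.
  by rewrite mxE enum_rankK cin.
move=> [v Av <-]; exists (fun c => v ord0 (enum_rank c)) => // c _.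
by have := Av (enum_rank c); rewrite /= in_itv.
Qed.

Lemma ind_split M J : valid M J ->
  edge_ind R M = edge_ind R (M :\: finset.cover J) + \sum_(c in J) edge_ind R (M :&: c).
Proof.
move=> [_ cJ dJ]; apply: weightP => e; rewrite weightD weight_sum !weight_ind finset.in_setD.
have [/bigcupP[c cin ec]|eJ] := boolP (e \in finset.cover J).
  have [cC _] := cJ c cin.
  rewrite (bigD1 c) //= big1 => [|d /andP[dJ' dc]].
    by rewrite weight_ind finset.in_setI ec andbT addr0 add0r.
  have cd : vdisjoint c d by apply: dJ => //; rewrite eq_sym.
  by rewrite weight_ind finset.in_setI (vdisjoint_edge cC cd ec) andbF.
rewrite big1 ?addr0 // => c cin; rewrite weight_ind finset.in_setI.
suff -> : e \in c = false by rewrite andbF.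
by apply: contraNF eJ => ec; apply/bigcupP; exists c.
Qed.

Lemma mcube_closed M J : closed (mcube M J).
Proof. by apply: compact_closed; [exact: norm_hausdorff|exact: mcube_compact]. Qed.

(** * Collapsing a cube from its top corner *)

Definition below (D : {set {set {set V}}}) : set W :=
  [set w | exists2 M, M \in D & mcube M (inward M) w]%classic.

Lemma below_closed D : closed (below D).
Proof.
apply: (@fin_union_ind _ _ (mem D) (fun M => mcube M (inward M)) closed); first exact: closed0.
  by move=> A B; exact: closedU.
by move=> M _; exact: mcube_closed.
Qed.

(** On the cube of [M] this is the least [1 - s c], the distance along the diagonal to the facets
    opposite [M]. Reading it from weights makes it a continuous function of [w] alone. *)
Definition slack M w : R := \big[Order.min/1]_(e in M :&: finset.cover (inward M)) weight w e.

Definition collapse M (tw : R * W) : W :=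
  tw.2 + (tw.1 * slack M tw.2) *: \sum_(c in inward M) turn M c.

Lemma slack_continuous M : continuous (slack M).
Proof.
apply: (@continuous_big R _ Order.min); first exact: min_continuous.
by move=> e _; exact: coord_continuous.
Qed.

Lemma collapse_continuous M : continuous (collapse M).
Proof.
move=> -[t w]; apply: (@cvgD R W _ (nbhs (t, w)) _ (fun tw : R * W => tw.2)
  (fun tw : R * W => (tw.1 * slack M tw.2) *: \sum_(c in inward M) turn M c)).
  exact: cvg_snd.
apply: (@cvgZ R W _ (nbhs (t, w)) _ (fun tw : R * W => tw.1 * slack M tw.2)
  (fun=> \sum_(c in inward M) turn M c)); last exact: cvg_cst.
apply: cvgM; first exact: cvg_fst.
apply: (@cvg_comp _ _ _ (fun tw : R * W => tw.2) (slack M) _ (nbhs w)); first exact: cvg_snd.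
exact: slack_continuous.
Qed.

Lemma collapse_mcube_pt M (t : R) s :
  collapse M (t, mcube_pt M (inward M) s) =
  mcube_pt M (inward M) (fun c => s c + t * slack M (mcube_pt M (inward M) s)).
Proof.
rewrite /collapse /= {1}/mcube_pt {2}/mcube_pt -addrA; congr (_ + _).
rewrite scaler_sumr -big_split /=; apply: eq_bigr => c _.
by rewrite -scalerDl.
Qed.

Lemma flippable_edge M c : c \in CC -> flippable M c -> exists2 e, e \in M & e \in c.
Proof.
move=> cC fM; have [f fc] := CC_edge cC; have [v vf] := CC_vertex cC fc.
by have [e [eM ec _] _] := flippable_once cC fM (in_cover fc vf); exists e.
Qed.

Section Slack.
Variables (M : {set {set V}}) (s : {set {set V}} -> R).
Hypothesis cM : reachable M.
Hypothesis s01 : forall c, c \in inward M -> 0 <= s c <= 1.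
Let w := mcube_pt M (inward M) s.
Let vM := valid_inward cM.

Lemma slack_ge0 : 0 <= slack M w.
Proof.
apply/bigmin_geP; split=> // e; rewrite finset.in_setI => /andP[eM /bigcupP[c cin ec]].
by rewrite (weight_pt_in _ vM cin ec) eM subr_ge0; case/andP: (s01 cin).
Qed.

Lemma slack_le c : c \in inward M -> slack M w <= 1 - s c.
Proof.
move=> cin; have [_ cJ _] := vM; have [cC fM] := cJ c cin.
have [e eM ec] := flippable_edge cC fM.
have <- : weight w e = 1 - s c by rewrite (weight_pt_in _ vM cin ec) eM.
apply: bigmin_le_cond; rewrite finset.in_setI eM /=.
by apply/bigcupP; exists c.
Qed.

Lemma slack_attained c0 : c0 \in inward M ->
  exists2 c, c \in inward M & s c + slack M w = 1.
Proof.
move=> c0in; apply: contrapT => h.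
have lt c : c \in inward M -> slack M w < 1 - s c.
  move=> cin; rewrite lt_neqAle slack_le // andbT; apply/eqP => e.
  by apply: h; exists c => //; rewrite e addrC subrK.
have : slack M w < slack M w.
  (* The default value 1 of the minimum must be exceeded too, which [c0] provides. *)
  rewrite {2}/slack; apply/bigmin_gtP; split.
    by apply: lt_le_trans (lt _ c0in) _; rewrite gerBl; case/andP: (s01 c0in).
  move=> e; rewrite finset.in_setI => /andP[eM /bigcupP[c cin ec]].
  by rewrite (weight_pt_in _ vM cin ec) eM lt.
by rewrite ltxx.
Qed.

(** Detects [M] from the point: by [positive_on_sub], any cube containing [w] then has all edges of
    [M] among its own. *)
Lemma slack_positive : 0 < slack M w -> positive_on M w.
Proof.
move=> sp e eM; have [/bigcupP[c cin ec]|eJ] := boolP (e \in finset.cover (inward M)).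
  by rewrite (weight_pt_in _ vM cin ec) eM; exact: lt_le_trans sp (slack_le cin).
by rewrite weight_pt_out // eM.
Qed.

Lemma collapse_Q (t : R) : 0 <= t <= 1 -> mcube M (inward M) (collapse M (t, w)).
Proof.
move=> /andP[t0 t1]; rewrite collapse_mcube_pt -/w.
exists (fun c => s c + t * slack M w) => // c cin.
have /andP[h0 h1] := s01 cin; have h2 := slack_le cin; have h3 := slack_ge0.
by apply/andP; split; [rewrite addr_ge0 // mulr_ge0|nra].
Qed.

End Slack.

(** On the facet [s c = 1] the corner [flip M c] has coordinate 0 along [c], and the other inward
    cycles of [M], being disjoint from [c], remain inward. *)
Lemma mcube_full M s c : reachable M -> c \in inward M ->
  (forall c, c \in inward M -> 0 <= s c <= 1) -> s c = 1 ->
  mcube (flip M c) (inward (flip M c)) (mcube_pt M (inward M) s).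
Proof.
move=> cM cin s01 s1; have vM := valid_inward cM.
have [_ cJ dJ] := vM; have [cC fM] := cJ c cin.
apply: (@mcube_widen _ _ (inward M :\ c)).
  apply/fintype.subsetP => d; rewrite finset.in_setD1 => /andP[dc din].
  by rewrite inward_flip_disj // dJ // eq_sym.
exists (fun d => if d == c then 1 - s c else s d).
  by move=> d; rewrite finset.in_setD1 => /andP[/negPf -> din]; exact: s01.
rewrite (mcube_pt_flip s vM cin); apply: mcube_pt_widen; first exact: finset.subD1set.
move=> d din; rewrite finset.in_setD1 din andbT negbK => /eqP ->.
by rewrite eqxx s1 subrr.
Qed.

Lemma inward0 : inward M0 = finset.set0.
Proof.
apply/finset.setP => c; rewrite inE (hgtE outward0) ffunE mul0r ltxx !andbF.
by rewrite inE.
Qed.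

(** Induction on [#|D|]: remove an [M] of maximal rank and slide its cube along the diagonal onto
    the facets away from [M], which lie in the remaining cubes. *)
Lemma below_contracts (D : {set {set {set V}}}) : M0 \in D -> (forall M, M \in D -> reachable M) ->
  (forall M c, M \in D -> c \in inward M -> flip M c \in D) ->
  contracts R (below D) (edge_ind R M0).
Proof.
have [n] := ubnP #|D|; elim: n D => // n IH D; rewrite ltnS => leD M0D Dcls Ddown.
have [D1|/set0Pn[M1 M1D]] := boolP (D :\ M0 == finset.set0).
  rewrite (_ : below D = [set edge_ind R M0]%classic); first exact: contracts1.
  have DE M : M \in D -> M = M0.
    move=> MD; apply/eqP; apply: contraT => MM0.
    by move/eqP: D1 => /finset.setP/(_ M); rewrite finset.in_setD1 MM0 MD inE.
  have QE : mcube M0 (inward M0) = [set edge_ind R M0]%classic.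
    rewrite inward0; apply/seteqP; split=> w.
      by move=> [s _ ->]; rewrite /mcube_pt finset.big_set0 addr0.
    move=> ->; exists (fun=> 0); first by move=> c; rewrite inE.
    by rewrite /mcube_pt finset.big_set0 addr0.
  apply/seteqP; split=> w; first by move=> [M /DE ->]; rewrite QE.
  by move=> wE; exists M0 => //; rewrite QE.
have [M] : exists2 M, M \in D :\ M0 & forall N, N \in D :\ M0 -> (rank N <= rank M)%N.
  by case: (@arg_maxnP _ M1 (mem (D :\ M0)) rank M1D) => M MD h; exists M.
rewrite finset.in_setD1 => /andP[MM0 MD] Mmax; have cM := Dcls M MD.
pose D' := D :\ M.
(* An inward flip cannot end at [M], since it would start at a larger rank. *)
have D'down N c : N \in D' -> c \in inward N -> flip N c \in D'.
  rewrite !finset.in_setD1 => /andP[NM ND] cin; rewrite Ddown // andbT.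
  apply/eqP => e.
  have NM0 : N != M0 by apply/eqP => NE; move: cin; rewrite NE inward0 inE.
  have := rank_flip (Dcls N ND) cin; rewrite e ltnNge Mmax //.
  by rewrite finset.in_setD1 NM0.
have D'reachable N : N \in D' -> reachable N by rewrite finset.in_setD1 => /andP[_]; exact: Dcls.
have M0D' : M0 \in D' by rewrite finset.in_setD1 eq_sym MM0.
rewrite (_ : below D = (mcube M (inward M) `|` below D')%classic); last first.
  apply/seteqP; split=> w.
    move=> [N ND QN]; have [NM|NM] := eqVneq N M; first by left; rewrite -NM.
    by right; exists N => //; rewrite finset.in_setD1 NM.
  move=> [QM|[N]]; first by exists M.
  by rewrite finset.in_setD1 => /andP[_ ND] QN; exists N.
have [c0 c0in] := inward_neq0 cM (elimN eqP MM0).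
apply: (@contracts_collapse R W _ _ _ (collapse M)).
- exact: mcube_closed.
- exact: below_closed.
- by apply: continuous_subspaceT; exact: collapse_continuous.
- move=> t w; rewrite /= in_itv /= => t01 [s s01 ->]; exact: collapse_Q.
- by move=> w _; rewrite /collapse /= mul0r scale0r addr0.
- move=> w [s s01 ->]; rewrite collapse_mcube_pt.
  have [c cin sc] := slack_attained cM s01 c0in.
  exists (flip M c).
    rewrite finset.in_setD1 Ddown // andbT; apply/eqP => e.
    by have := rank_flip cM cin; rewrite e ltnn.
  apply: mcube_full => //; last by rewrite mul1r.
  move=> d din; have /andP[h0 h1] := s01 d din; have h2 := slack_le s cM din.
  have h3 := slack_ge0 cM s01.
  by apply/andP; split; lra.
(* A point shared with a remaining cube has slack 0 and stays fixed: positive slack would make [M] a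
   corner of the cube of [N], hence a member of [D']. *)
- move=> t w _ [s s01 ->] [N ND' QN].
  have h3 := slack_ge0 cM s01.
  rewrite /collapse /=; suff -> : slack M (mcube_pt M (inward M) s) = 0 by rewrite mulr0 scale0r addr0.
  apply/eqP; rewrite eq_le h3 andbT leNgt; apply/negP => sp.
  have /(positive_on_sub QN) MN := slack_positive cM sp.
  have : M \in D' := inward_closed_valid D'reachable D'down ND' (reachable_pm cM) MN.
  by rewrite finset.in_setD1 eqxx.
- by apply: IH => //; apply: leq_trans leD; rewrite [in ltnRHS](cardsD1 M) MD.
Qed.

(** * Connected components of the union of cubes *)

Definition cubes : set W := [set w | exists M J, valid M J /\ mcube M J w]%classic.

Definition reachable_set : {set {set {set V}}} := [set M | `[< reachable M >]].

Lemma below_reachable M J w : reachable M -> valid M J -> mcube M J w -> below reachable_set w.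
Proof.
move=> cM vM QM.
have [|N [cN vN JN QN]] := @valid_top (fun M' => mcube M' J w) M J cM vM QM.
  by move=> M' c vM' cin; exact: mcube_flip.
exists N; last exact: mcube_widen QN.
by rewrite inE; apply/asboolP.
Qed.

(** The cubes at reachable corners form a contractible, hence connected, closed set; the cubes at
    unreachable corners form a closed set [Y] disjoint from it. *)
Lemma component_below J w : valid M0 J -> mcube M0 J w ->
  connected_component cubes w = below reachable_set /\ contracts R (below reachable_set) (edge_ind R M0).
Proof.
move=> v0 Q0.
have bw : below reachable_set w by exact: below_reachable reachable0 v0 Q0.
have clsP M : M \in reachable_set -> reachable M by rewrite inE => /asboolP.
have con : contracts R (below reachable_set) (edge_ind R M0).
  apply: below_contracts => //; first by rewrite inE; apply/asboolP; exact: reachable0.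
  move=> M c /clsP cM /inwardP[cC fM _]; rewrite inE; apply/asboolP; exact: reachable_flip.
split=> //; apply/seteqP; split=> u; last first.
  apply: connected_component_max => //; last exact: contracts_connected con.
  move=> x [M /clsP cM QM]; exists M, (inward M); split=> //; exact: valid_inward.
pose Y := [set x : W | exists2 MJ : {set {set V}} * {set {set {set V}}},
  `[< valid MJ.1 MJ.2 /\ ~ reachable MJ.1 >] & mcube MJ.1 MJ.2 x]%classic.
have cY : closed Y.
  apply: (@fin_union_ind _ _ _ (fun MJ : {set {set V}} * {set {set {set V}}} => mcube MJ.1 MJ.2) closed).
  - exact: closed0.
  - by move=> A B; exact: closedU.
  - by move=> MJ _; exact: mcube_closed.
have tot x : cubes x -> below reachable_set x \/ Y x.
  move=> [M [J' [vM QM]]]; have [cM|cM] := pselect (reachable M).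
    by left; exact: below_reachable cM vM QM.
  by right; exists (M, J') => //; apply/asboolP.
(* A common point is positive on some corner [M'] of the second cube. Then [M'] is a corner of the
   first cube too, so it is reachable, and so is [M]. *)
have dis x : below reachable_set x -> ~ Y x.
  move=> [N /clsP cN QN] [[M J'] /asboolP [/= vM nM] QM].
  have [M' [vM' QM' pM' sub]] := mcube_positive vM QM; apply: nM.
  have [pmM' _ _] := vM'; have [pmM _ _] := vM.
  have cM' : reachable M' := reachable_valid cN (valid_inward cN) pmM' (positive_on_sub QN pM').
  exact: reachable_valid cM' vM' pmM sub.
move=> [C [Cw Ct cC] Cu].
have : (C `&` below reachable_set)%classic = C.
  apply: cC; first by exists w.
  - exists (~` Y)%classic; first exact: closed_openC.
    apply/seteqP; split=> x [Cx]; first by move=> /dis.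
    by move=> nY; split=> //; case: (tot x (Ct x Cx)).
  - exists (below reachable_set) => //; exact: below_closed.
by move=> e; move: Cu; rewrite -e => -[].
Qed.

End Cubes.

End Flips.

Lemma scaler_convex (K : nzRingType) (U : lmodType K) (a : K) (x y : U) :
  a *: x + (1 - a) *: y = x + (1 - a) *: (y - x).
Proof.
by rewrite scalerBr !scalerBl !scale1r opprB [RHS]addrCA [x + _]addrC subrK addrC.
Qed.

(** * Faces of the complex as cubes with a base corner *)

Section Complex.
Variables (R : realType) (V : finType) (G : plane_graph R V).

Definition even_cycles : {set {set {set V}}} := [set c | `[< even_elementary G c >]].
Local Notation E := (edges G).
Local Notation CC := even_cycles.

Lemma even_cyclesP c : reflect (even_elementary G c) (c \in CC).
Proof. by rewrite inE; exact: asboolP. Qed.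

Lemma set0_notin_edges : finset.set0 \notin E.
Proof.
apply/negP => /edge_adj[x [y [_ /finset.setP /(_ x)]]].
by rewrite in_set2 eqxx inE.
Qed.

Lemma even_cycles_cycle c : c \in CC -> is_cycle G c.
Proof. by move=> /even_cyclesP[[]]. Qed.

Lemma even_cycles_elementary c : c \in CC -> elementary G c.
Proof. by move=> /even_cyclesP[]. Qed.

Lemma even_cycles_circuit c : c \in CC -> circuit c.
Proof. by move=> /even_cycles_cycle; exact: cycle_circuit. Qed.

Lemma even_cycles_edges c : c \in CC -> c \subset E.
Proof. by move=> /even_cycles_cycle; exact: cycle_edges. Qed.

Lemma cube_valid F (w : 'rV[R]_#|{set V}|) : is_face G F -> cube F w ->
  exists M J, valid E CC M J /\ mcube M J w.
Proof.
case: F => MF CF [/= evF dF /andP[MFE MFp]] [S [t [altS t01 ->]]] /=.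
have CFC c : c \in CF -> c \in CC by move=> cF; apply/even_cyclesP; exact: evF.
(* The corner where all [t c] equal 1; coordinates measured from it are therefore [1 - t c]. *)
pose M := MF :|: \bigcup_(c in CF) S c.
have altP c : c \in CF -> S c \subset c /\ {in finset.cover c, forall v, covers_once (S c) v}.
  move=> cF; apply/(alternateP _ (CC_set0 even_cycles_circuit (CFC c cF))); exact: altS.
have Sc c e : c \in CF -> e \in S c -> e \in c.
  by move=> /altP[/fintype.subsetP h _] /h.
have same c d v : c \in CF -> d \in CF -> v \in finset.cover c -> v \in finset.cover d -> c = d.
  move=> cF dF' vc vd; apply/eqP; apply: contraT => cd.
  by have /disjointFr /(_ vc) := dF c d cF dF' cd; rewrite vd.
have MFout e v : e \in MF -> v \in e -> forall c, c \in CF -> v \in finset.cover c -> False.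
  move=> eM ve c cF vc.
  have : e \subset ~: \bigcup_(c in CF) finset.cover c.
    by have /and3P[/eqP <- _ _] := MFp; apply: finset.bigcup_sup.
  move=> /fintype.subsetP /(_ v ve); rewrite finset.in_setC => /negP; apply.
  by apply/bigcupP; exists c.
have MP e : e \in M -> e \in MF \/ exists2 c, c \in CF & e \in S c.
  by rewrite finset.in_setU => /orP[|/bigcupP[c cF eS]]; [left|right; exists c].
have McS c : c \in CF -> M :&: c = S c.
  move=> cF; apply/finset.setP => e; rewrite finset.in_setI; apply/andP/idP.
    move=> [/MP[eM|[d dF' eS]] ec].
      have [v ve] := CC_vertex even_cycles_circuit (CFC c cF) ec.
      by case: (MFout e v eM ve c cF (in_cover ec ve)).
    have [v ve] := CC_vertex even_cycles_circuit (CFC c cF) ec.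
    by rewrite (same c d v) // ?(in_cover ec ve) // (in_cover (Sc _ _ dF' eS) ve).
  move=> eS; split; last exact: Sc eS.
  by rewrite finset.in_setU; apply/orP; right; apply/bigcupP; exists c.
have vM : valid E CC M CF.
  split=> //.
  - split.
      apply/fintype.subsetP => e /MP[|[c cF eS]]; first exact: (fintype.subsetP MFE).
      exact: (fintype.subsetP (even_cycles_edges (CFC c cF)) _ (Sc _ _ cF eS)).
    move=> v; have [/bigcupP[c cF vc]|vC] := boolP (v \in \bigcup_(c in CF) finset.cover c).
      have [_ /(_ v vc)[e [eS ve] eU]] := altP c cF.
      exists e.
        by split=> //; rewrite finset.in_setU; apply/orP; right; apply/bigcupP; exists c.
      move=> f /MP[fM vf|[d dF' fS] vf]; first by case: (MFout f v fM vf c cF vc).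
      by apply: eU => //; rewrite (same c d v) // (in_cover (Sc _ _ dF' fS) vf).
    have [e [eM ve] eU] : covers_once MF v.
      by apply: partition_once MFp _; rewrite finset.in_setC.
    exists e; first by rewrite finset.in_setU eM.
    move=> f /MP[fM vf|[d dF' fS] vf]; first exact: eU.
    case/negP: vC; apply/bigcupP; exists d => //.
    exact: in_cover (Sc _ _ dF' fS) vf.
  - by move=> c cF; split; [exact: CFC|rewrite /flippable McS //; exact: altS].
exists M, CF; split=> //; exists (fun c => 1 - t c).
  move=> c cF; have /andP[t0 t1] := t01 c cF.
  by apply/andP; split; lra.
rewrite /mcube_pt (ind_split even_cycles_circuit R vM).
rewrite (_ : M :\: finset.cover CF = MF); last first.
  apply/finset.setP => e; rewrite finset.in_setD; apply/andP/idP.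
    move=> [eC /MP[//|[c cF eS]]]; case/negP: eC; apply/bigcupP; exists c => //; exact: Sc eS.
  move=> eM; split; last by rewrite finset.in_setU eM.
  apply/negP => /bigcupP[c cF ec].
  have [v ve] := CC_vertex even_cycles_circuit (CFC c cF) ec.
  exact: (MFout e v eM ve c cF (in_cover ec ve)).
rewrite -addrA; congr (_ + _); rewrite -big_split /=; apply: eq_bigr => c cF.
rewrite /turn McS // (_ : c :\: M = c :\: S c); last first.
  apply/finset.setP => e; rewrite -McS // !finset.in_setD finset.in_setI.
  by case: (e \in c); rewrite ?andbT ?andbF.
exact: scaler_convex.
Qed.

(** An edge of [M] that touches a cycle of [J] lies on it, so the remaining edges of [M] match
    exactly the vertices off these cycles. *)
Lemma valid_complex M J (w : 'rV[R]_#|{set V}|) : valid E CC M J -> mcube M J w -> cubical_complex G w.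
Proof.
move=> vM [s s01 ->]; have [[ME MO] cJ dJ] := vM.
exists (M :\: finset.cover J, J).
  split=> /=.
  - by move=> c /cJ[/even_cyclesP].
  - exact: dJ.
  apply/andP; split; first exact: fintype.subset_trans (finset.subsetDl _ _) ME.
  have MJ e v c : e \in M -> v \in e -> c \in J -> v \in finset.cover c -> e \in c.
    move=> eM ve cin vc; have [cC fM] := cJ c cin.
    have [f [fM' fc vf] _] := flippable_once even_cycles_circuit cC fM vc.
    by rewrite (covers_once_uniq (MO v) eM fM' ve vf).
  apply: once_partition.
  - apply: contra set0_notin_edges; rewrite finset.in_setD => /andP[_].
    exact: (fintype.subsetP ME).
  - move=> e; rewrite finset.in_setD => /andP[eC eM]; apply/fintype.subsetP => v ve.
    rewrite finset.in_setC; apply: contra eC => /bigcupP[c cin vc].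
    by apply/bigcupP; exists c => //; exact: MJ vc.
  - move=> v; rewrite finset.in_setC => vC; have [e [eM ve] eU] := MO v.
    exists e; last by move=> f; rewrite finset.in_setD => /andP[_ fM]; exact: eU.
    split=> //; rewrite finset.in_setD eM andbT; apply: contra vC => /bigcupP[c cin ec].
    by apply/bigcupP; exists c => //; exact: in_cover ve.
exists (fun c => M :&: c), (fun c => 1 - s c); split=> /=.
- by move=> c /cJ[].
- by move=> c /s01 /andP[s0 s1]; apply/andP; split; lra.
rewrite /mcube_pt (ind_split even_cycles_circuit R vM) -addrA; congr (_ + _).
rewrite -big_split /=; apply: eq_bigr => c cin.
rewrite /turn (_ : c :\: (M :&: c) = c :\: M); last first.
  apply/finset.setP => e; rewrite !finset.in_setD finset.in_setI.
  by case: (e \in c); rewrite ?andbT ?andbF.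
by rewrite scaler_convex subKr.
Qed.

End Complex.

Theorem theorem3p6 (R : realType) (V : finType) (G : plane_graph R V)
    (hM : exists M : {set {set V}}, perfect_matching G M) :
  forall w, cubical_complex G w ->
    contractible R (connected_component (cubical_complex G) w).
Proof.
(* A corner of a cube containing [w] becomes the base point of the heights for the component of
   [w]. *)
move=> w [F fF Fw]; have [M0 [J [v0 Q0]]] := cube_valid fF Fw.
have XE : cubical_complex G = cubes (edges G) (even_cycles G) (R := R).
  apply/seteqP; split=> u.
    by move=> [F' fF' Fu]; exact: cube_valid fF' Fu.
  by move=> [M [J' [vM QM]]]; exact: valid_complex QM.
have [pm0 _ _] := v0.
have two e c1 c2 c3 : c1 \in even_cycles G -> c2 \in even_cycles G -> c3 \in even_cycles G ->
    e \in c1 -> e \in c2 -> e \in c3 -> c1 != c2 -> c1 != c3 -> c2 != c3 -> False.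
  move=> /even_cycles_elementary h1 /even_cycles_elementary h2 /even_cycles_elementary h3.
  exact: (edge_at_most_two h1 h2 h3).
have priv (S : {set {set {set V}}}) c0 : c0 \in S -> (forall c, c \in S -> c \in even_cycles G) ->
    exists e c, [/\ c \in S, e \in c & forall c', c' \in S -> e \in c' -> c' = c].
  by move=> c0S h; apply: (@private_edge R V G S c0 c0S) => c /h /even_cycles_elementary.
have [e con] := @component_below V (edges G) (even_cycles G) (set0_notin_edges G)
  (@even_cycles_circuit R V G) (@even_cycles_edges R V G) two priv M0 pm0 R J w v0 Q0.
by rewrite XE e; exact: contracts_contractible con.
Qed.
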